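(* Let $d\ge 1$, let $0<a_1,\dots,a_d<1$ be real numbers and let $b_1,\dots,b_d\ge 2$ be integers with $a_1b_1>1,\dots,a_db_d>1$. For $t\in[0,1]$ and $N\in\mathbb N$ let $$W(t)=(W^1(t),\dots,W^d(t))=\left(\sum_{k=0}^\infty a_1^k\cos(b_1^k\pi t),\dots,\sum_{k=0}^\infty a_d^k\cos(b_d^k\pi t)\right),$$ $$W_N(t)=(W_N^1(t),\dots,W_N^d(t))=\left(\sum_{k=0}^N a_1^k\cos(b_1^k\pi t),\dots,\sum_{k=0}^N a_d^k\cos(b_d^k\pi t)\right).$$ Then for all $1\le i,j\le d$ and all $0\le s\le t\le 1$ the limit $$I^{i,j}(s,t):=\lim_{N\to\infty}\int_s^t\bigl(W_N^i(r)-W_N^i(s)\bigr)\,dW_N^j(r)$$ exists. Furthermore, if $-\frac{\ln a_i}{\ln b_i}>\frac13$ for all $1\le i\le d$, then the matrix with entries $I^{i,j}(s,t)$ defines a geometric rough path above $W$; that is, there is $\gamma\in(1/3,1/2]$ such that the map $(s,t)\mapsto\bigl(W(t)-W(s),(I^{i,j}(s,t))_{1\le i,j\le d}\bigr)$ belongs to $\mathscr C_g^\gamma$.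
   Context: The integrals of the smooth functions $W_N^i$ are Riemann-Stieltjes integrals. Let $\Delta_2=\{(s,t):0\le s\le t\le 1\}$ and $\gamma\in(1/3,1/2]$. For $f:[0,1]\to\mathbb R^d$, $f$ is $\gamma$-Hölder, written $f\in C^\gamma([0,1],\mathbb R^d)$, if $\sup_{s\ne t}\frac{|f(t)-f(s)|}{|t-s|^\gamma}<\infty$. Given $X\in C^\gamma([0,1],\mathbb R^d)$, a rough path above $X$ is a map $\mathbf X=(X_{s,t},\mathbb X_{s,t}):\Delta_2\to\mathbb R^d\oplus\mathbb R^{d\times d}$ such that for all $0\le s\le u\le t\le 1$: (i) $X_{s,t}=X(t)-X(s)$; (ii) $\mathbb X_{s,t}-\mathbb X_{s,u}-\mathbb X_{u,t}=X_{s,u}\otimes X_{u,t}$ (the matrix with $(i,j)$ entry $X^i_{s,u}X^j_{u,t}$); (iii) $\|\mathbf X\|_{\gamma,2\gamma}:=\sup_{s\neq t}\frac{|X_{s,t}|}{|t-s|^\gamma}+\sup_{s\ne t}\frac{|\mathbb X_{s,t}|}{|t-s|^{2\gamma}}<\infty$, where $|\cdot|$ is any norm on $\mathbb R^d$, respectively $\mathbb R^{d\times d}$. The set of all rough paths (above all such $X$) is denoted $\mathscr C^\gamma$, and it is equipped with the distance $\|\mathbf X-\mathbf Y\|_{\gamma,2\gamma}$, where the difference is taken componentwise. For $f\in C^\infty([0,1],\mathbb R^d)$ let $\iota(f)_{s,t}=\bigl(f(t)-f(s),\int_s^t(f(r)-f(s))\otimes f'(r)\,dr\bigr)$, where the second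 component is the matrix with $(i,j)$ entry $\int_s^t(f^i(r)-f^i(s))(f^j)'(r)\,dr$. The space $\mathscr C_g^\gamma$ of geometric rough paths is the closure in $\mathscr C^\gamma$ of $\iota(C^\infty([0,1],\mathbb R^d))$ with respect to $\|\cdot\|_{\gamma,2\gamma}$. *)

(* Defs.v *)
From HB Require Import structures.
From mathcomp Require Import all_boot all_order all_algebra.
From mathcomp Require Import all_classical all_reals all_analysis.

Set Implicit Arguments.
Unset Strict Implicit.
Unset Printing Implicit Defensive.

Import Order.TTheory GRing.Theory Num.Theory.
Import numFieldNormedType.Exports.

Local Open Scope classical_set_scope.
Local Open Scope ring_scope.

(* Paths on [0, 1] and maps on {0 <= s <= t <= 1} are represented by total
   functions on R and on R * R; every notion below depends only on their values
   on [0, 1] and on {0 <= s <= t <= 1}.  The norms on 'rV[R]_d and 'M[R]_d are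
   the library's max norms. *)

Section RiemannStieltjes.
Variable R : realType.
Implicit Types (f g : R -> R) (a b : R) (p : seq R) (xi : nat -> R).

(* For itv_partition a b p, the points of the subdivision are a :: p (the last
   one being b) and the k-th interval is [part_pt a p k, part_pt a p k.+1],
   for k < size p. *)
Definition part_pt a p (k : nat) : R := nth 0 (a :: p) k.

Definition is_tagging a p xi : Prop :=
  forall k, (k < size p)%N -> part_pt a p k <= xi k <= part_pt a p k.+1.

Definition mesh_lt a p (delta : R) : Prop :=
  forall k, (k < size p)%N -> part_pt a p k.+1 - part_pt a p k < delta.

Definition RS_sum f g a p xi : R :=
  \sum_(k < size p) f (xi k) * (g (part_pt a p k.+1) - g (part_pt a p k)).

Definition is_RS_integral f g a b (l : R) : Prop :=
  forall eps : R, 0 < eps -> exists2 delta : R, 0 < delta &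
    forall p xi, itv_partition a b p -> is_tagging a p xi ->
      mesh_lt a p delta -> `|RS_sum f g a p xi - l| < eps.

(* The integral of f with respect to g over [a, b]; the default value 0 is
   used when f is not Riemann-Stieltjes integrable with respect to g. *)
Definition RS_integral f g a b : R := xget 0 (is_RS_integral f g a b).

End RiemannStieltjes.

Section Smooth.
Variable R : realType.

Definition diff_quotient01 (f : R -> R) (x : R) : set_system R :=
  (f y - f x) / (y - x) @[y --> within `[0, 1] x^'].

(* The derivative of f as a function on [0, 1], hence one-sided at 0 and 1. *)
Definition deriv01 (f : R -> R) (x : R) : R := lim (diff_quotient01 f x).

Definition smooth01 (f : R -> R) : Prop :=
  forall (n : nat) (x : R), 0 <= x <= 1 ->
    cvg (diff_quotient01 (iter n deriv01 f) x).

End Smooth.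

Section RoughPaths.
Variables (R : realType) (d : nat).
Implicit Types (gam : R) (X : R -> 'rV[R]_d)
  (XX YY : R -> R -> 'rV[R]_d * 'M[R]_d).

Definition holder_norm gam X : \bar R :=
  ereal_sup [set (`|X st.2 - X st.1| / `|st.2 - st.1| `^ gam)%:E
     | st in [set st : R * R |
                [/\ 0 <= st.1 <= 1, 0 <= st.2 <= 1 & st.1 != st.2]]].

Definition holder2_norm (V : normedModType R) gam (F : R -> R -> V) : \bar R :=
  ereal_sup [set (`|F st.1 st.2| / `|st.2 - st.1| `^ gam)%:E
     | st in [set st : R * R |
                [/\ 0 <= st.1, st.1 <= st.2, st.2 <= 1 & st.1 != st.2]]].

Definition rough_norm gam XX : \bar R :=
  (holder2_norm gam (fun s t => (XX s t).1) +
   holder2_norm (2 * gam) (fun s t => (XX s t).2))%E.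

Definition rough_dist gam XX YY : \bar R :=
  rough_norm gam (fun s t => XX s t - YY s t).

Definition outer (u v : 'rV[R]_d) : 'M[R]_d := \matrix_(i, j) (u 0 i * v 0 j).

Definition rough_path_above gam X XX : Prop :=
  [/\ (holder_norm gam X < +oo)%E,
      forall s t, 0 <= s -> s <= t -> t <= 1 -> (XX s t).1 = X t - X s,
      forall s u t, 0 <= s -> s <= u -> u <= t -> t <= 1 ->
        (XX s t).2 - (XX s u).2 - (XX u t).2
        = outer (XX s u).1 (XX u t).1 &
      (rough_norm gam XX < +oo)%E].

Definition rough_path gam XX : Prop := exists X, rough_path_above gam X XX.

Definition smooth_path (f : R -> 'rV[R]_d) : Prop :=
  forall i, smooth01 (fun r => f r 0 i).

Definition smooth_lift (f : R -> 'rV[R]_d) (s t : R) : 'rV[R]_d * 'M[R]_d :=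
  (f t - f s,
   \matrix_(i, j) \int[lebesgue_measure]_(r in `[s, t]%classic)
     ((f r 0 i - f s 0 i) * deriv01 (fun x => f x 0 j) r)).

Definition geometric_rough_path gam XX : Prop :=
  rough_path gam XX /\
  forall eps : R, 0 < eps -> exists2 f, smooth_path f &
    (rough_dist gam XX (smooth_lift f) < eps%:E)%E.

End RoughPaths.

Section Weierstrass.
Variables (R : realType) (d : nat) (a : 'I_d -> R) (b : 'I_d -> nat).

Definition weierstrass_partial (N : nat) (t : R) : 'rV[R]_d :=
  \row_i \sum_(0 <= k < N.+1) a i ^+ k * cos ((b i)%:R ^+ k * pi * t).

Definition weierstrass (t : R) : 'rV[R]_d :=
  \row_i limn (series (fun k => a i ^+ k * cos ((b i)%:R ^+ k * pi * t))).

Definition iterated_integral (i j : 'I_d) (s t : R) (N : nat) : R :=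
  RS_integral
    (fun r => weierstrass_partial N r 0 i - weierstrass_partial N s 0 i)
    (fun r => weierstrass_partial N r 0 j) s t.

Definition weierstrass_lift (s t : R) : 'rV[R]_d * 'M[R]_d :=
  (weierstrass t - weierstrass s,
   \matrix_(i, j) limn (iterated_integral i j s t)).

End Weierstrass.

(* Main.v *)
Require Import Defs.
From HB Require Import structures.
From mathcomp Require Import all_boot all_order all_algebra.
From mathcomp Require Import all_classical all_reals all_analysis.
From mathcomp Require Import perm ring lra zify.

Set Implicit Arguments.
Unset Strict Implicit.
Unset Printing Implicit Defensive.

Import Order.TTheory GRing.Theory Num.Theory.
Import numFieldNormedType.Exports.

Local Open Scope classical_set_scope.
Local Open Scope ring_scope.

(** The integrals of trigonometric polynomials are explicit: the form
    cos (p pi r) d cos (q pi r) has a primitive built from cos ((p + q) pi r)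
    and cos ((p - q) pi r) with coefficients q / (p + q) and q / (p - q).
    Summing over the frequencies p = b_i ^ k and q = b_j ^ l, the iterated
    integrals become partial sums of a double series, and the only obstruction
    to its convergence is the small divisor p - q.

    The arithmetic core is therefore [power_gap]: for integers b, c >= 2 and
    every rho > 1, the number c ^ l is at most C rho ^ (k + l) |b ^ k - c ^ l|
    whenever b ^ k and c ^ l differ.  No power of the frequencies may be lost
    here, since the a_i may be close to 1.  Equivalently, the linear form
    k ln b - l ln c is not exponentially small in k + l.  After division by
    gcd (k, l) this is [coprime_linear_form_ge], proved with interpolation
    determinants.  The natural numbers (l r + k s) ^ i (b ^ r c ^ s) ^ j, with i
    and j indexing the rows and suitable pairs (r, s) the columns, form a
    determinant that is nonzero by a zero estimate ([zero_estimate]), hence at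
    least 1 in absolute value.  If k ln b - l ln c were tiny, they would nearly
    be the values of x ^ i e ^ (j w x), with w = ln b / l, at the points
    x = l r + k s; but a determinant of values of N entire functions at N points
    is tiny once N is large compared with their growth ([det_exp_rows_le]).  This
    contradiction is quantified in [linear_form_interpolation].

    Let gam be in [0, 1/2] with a_i b_i ^ gam < 1 for all i.  By [cos_area_le]
    the integral of cos (p pi r) - cos (p pi s) against d cos (q pi r) over
    [s, t] is at most a constant times G p ^ gam q ^ gam |t - s| ^ (2 gam) when
    p and q are at most G |p - q| or p = q.  With G = C rho ^ (k + l) and rho
    close to 1, the double series converges geometrically, with a factor
    |t - s| ^ (2 gam) in all bounds ([area_partial_step], [geometric_cauchy]).
    The exponent gam = 0 gives the existence of the limits.  An exponent
    gam > 1/3, available when every - ln a_i / ln b_i exceeds 1/3, gives the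
    Hoelder bounds of the limit and of its distance to the lifts of the smooth
    paths W_N.  Chen's relation holds at each N by an algebraic identity and
    passes to the limit. *)

(** * Estimates for determinants *)

Lemma prod_dist_le (R : realDomainType) (n : nat) (f g : 'I_n -> R) (Q e : R) :
  1 <= Q -> (forall i, `|f i| <= Q) -> (forall i, `|g i| <= Q) ->
  (forall i, `|f i - g i| <= e) ->
  `|\prod_i f i - \prod_i g i| <= n%:R * Q ^+ n * e.
Proof.
move=> Q1; have Q0 : 0 <= Q by apply: le_trans Q1.
elim: n f g => [|n IH] f g fQ gQ fge.
  by rewrite !big_ord0 subrr normr0 mul0r mul0r.
have e0 : 0 <= e by apply: le_trans (fge ord0); exact: normr_ge0.
rewrite !big_ord_recl /=.
set F := \prod_(i < n) _; set G := \prod_(i < n) _.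
have -> : f ord0 * F - g ord0 * G = (f ord0 - g ord0) * F + g ord0 * (F - G).
  by ring.
have FQ : `|F| <= Q ^+ n.
  rewrite /F normr_prod -[n in Q ^+ n]card_ord -prodr_const.
  by apply: ler_prod => i _; rewrite normr_ge0 fQ.
apply: le_trans (ler_normD _ _) _; rewrite !normrM.
have IH' := IH _ _ (fun i => fQ (lift ord0 i)) (fun i => gQ (lift ord0 i))
  (fun i => fge (lift ord0 i)).
have h1 : `|f ord0 - g ord0| * `|F| <= e * Q ^+ n.+1.
  apply: ler_pM => //; apply: le_trans FQ _.
  by rewrite exprS ler_peMl // exprn_ge0.
have h2 : `|g ord0| * `|F - G| <= Q * (n%:R * Q ^+ n * e) by apply: ler_pM.
apply: le_trans (lerD h1 h2) _.
by rewrite -natr1 exprS le_eqVlt; apply/orP; left; apply/eqP; ring.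
Qed.

(** The factor Q ^ n is affordable: in the application log n and log Q are
    bounded by powers of log l, whereas e is exponentially small in l. *)
Lemma det_dist_le (R : realDomainType) (n : nat) (A B : 'M[R]_n) (Q e : R) :
  1 <= Q -> (forall i j, `|A i j| <= Q) -> (forall i j, `|B i j| <= Q) ->
  (forall i j, `|A i j - B i j| <= e) ->
  `|\det A - \det B| <= n`!%:R * (n%:R * Q ^+ n * e).
Proof.
move=> Q1 AQ BQ ABe; rewrite /determinant -sumrB.
apply: le_trans (ler_norm_sum _ _ _) _.
rewrite -card_Sn mulr_natl -sumr_const.
apply: ler_sum => s _.
rewrite -mulrBr normrM normr_sign mul1r.
exact: prod_dist_le.
Qed.

(** The extremal case is the identity: removing the largest of n + 1 distinct
    values, which is at least n, leaves n distinct values. *)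
Lemma leq_bin2_sum_inj (n : nat) (g : 'I_n -> nat) :
  injective g -> ('C(n, 2) <= \sum_i g i)%N.
Proof.
elim: n g => [|n IH] g gi; first by rewrite big_ord0.
pose i0 := [arg max_(i > ord0) g i]%N.
have gmax i : (g i <= g i0)%N.
  by rewrite /i0; case: arg_maxnP => // j _; apply.
have g_lt i : (g i < (g i0).+1)%N by rewrite ltnS.
have n_le : (n <= g i0)%N.
  have h := @leq_card _ _ (fun i => Ordinal (g_lt i)).
  rewrite -ltnS -[n.+1]card_ord -[(g i0).+1]card_ord; apply: h.
  by move=> i j /(congr1 val) /= /gi.
rewrite (bigD1_ord i0) //= binS bin1 addnC leq_add //.
by apply: IH => i j /gi /lift_inj.
Qed.

(** A real form of the Schwarz lemma used with interpolation determinants.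
    Expand every row in powers of the nodes: a choice of exponents in which two
    rows agree contributes a vanishing determinant, so the exponents are distinct
    and their sum is at least 'C(n, 2).  Replacing T by E T in the trivial bound
    therefore gains at least E ^ 'C(n, 2). *)
Lemma det_power_rows_le (R : realFieldType) (n m : nat) (C : 'I_n -> 'I_m -> R)
    (x : 'I_n -> R) (T E : R) :
  (forall i k, 0 <= C i k) -> (forall j, 0 <= x j <= T) -> 1 <= E ->
  `|\det (\matrix_(i, j) \sum_k C i k * x j ^+ k)| * E ^+ 'C(n, 2)
   <= n`!%:R * \prod_i \sum_k C i k * (E * T) ^+ k.
Proof.
move=> C0 xT E1; have E0 : 0 <= E by apply: le_trans E1.
set D := \det _.
have -> : D = \sum_(g : {ffun 'I_n -> 'I_m})
    (\prod_i C i (g i)) * \det (\matrix_(i, j) x j ^+ g i).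
  transitivity (\sum_(s : 'S_n) \sum_(g : {ffun 'I_n -> 'I_m})
      (-1) ^+ s * \prod_i (C i (g i) * x (s i) ^+ g i)).
    apply: eq_bigr => s _; rewrite -big_distrr /=; congr (_ * _).
    rewrite -(bigA_distr_bigA (fun i k => C i k * x (s i) ^+ k)) /=.
    by apply: eq_bigr => i _; rewrite mxE.
  rewrite exchange_big; apply: eq_bigr => g _ /=.
  rewrite /determinant big_distrr /=; apply: eq_bigr => s _.
  rewrite big_split /= mulrCA; congr (_ * (_ * _)).
  by apply: eq_bigr => i _; rewrite mxE.
rewrite bigA_distr_bigA /= mulr_sumr.
apply: le_trans (ler_wpM2r _ (ler_norm_sum _ _ _)) _; first exact: exprn_ge0.
rewrite mulr_suml; apply: ler_sum => g _.
have [/injectiveP gi | /injectivePn [i1 [i2 Di12 gi]]] := boolP (injectiveb g);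
  last first.
  rewrite (determinant_alternate Di12); last by move=> j; rewrite !mxE gi.
  rewrite mulr0 normr0 mul0r mulr_ge0 ?ler0n // prodr_ge0 // => i _.
  rewrite mulr_ge0 // exprn_ge0 // mulr_ge0 //.
  by have /andP[a b] := xT i; exact: le_trans b.
have P0 : 0 <= \prod_i C i (g i) by apply: prodr_ge0.
rewrite big_split /= normrM (ger0_norm P0) -mulrA [leRHS]mulrCA ler_wpM2l //.
under eq_bigr => i _ do rewrite exprMn.
rewrite big_split /= mulrCA mulrC.
apply: ler_pM; rewrite ?exprn_ge0 //.
  rewrite -[leLHS]mul1r; rewrite prodrXr.
  by rewrite mul1r ler_weXn2l // leq_bin2_sum_inj // => i j /val_inj /gi.
rewrite /determinant; apply: le_trans (ler_norm_sum _ _ _) _.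
rewrite -card_Sn mulr_natl -sumr_const.
apply: ler_sum => s _.
rewrite normrM normr_sign mul1r normr_prod ler_prod // => i _.
have /andP[a b] := xT (s i).
by rewrite mxE normr_ge0 normrX ger0_norm // lerXn2r ?nnegrE // (le_trans a).
Qed.

(** * A zero estimate and integer minors *)

(** A polynomial P(X, Y) = sum_j p_j(X) Y ^ j cannot vanish at all the points
    (l r + k s, b ^ r c ^ s).  If it did, the L translates of P by the multiples of
    (l, b) would give, at each of M ^ 2 points, L linear relations with the nonzero
    solution (Y ^ j)_j.  Then the determinant of the p_j(X + l i) b ^ (j i) would
    have M ^ 2 roots, more than its degree, while its leading coefficient is a
    nonzero multiple of a Vandermonde determinant in the b ^ j. *)
Lemma zero_estimate (F : realFieldType) (b c k l K L M : nat)
    (p : 'I_L -> {poly F}) (j0 : 'I_L) :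
  (1 < b)%N -> (0 < c)%N -> coprime k l -> (M <= l)%N ->
  (K.-1 * L < M * M)%N -> (forall j, size (p j) <= K)%N -> p j0 != 0 ->
  exists r s, [/\ (r < L + M)%N, (s < M)%N &
    \sum_j (p j).[(l * r + k * s)%:R] * ((b ^ r * c ^ s)%:R) ^+ j != 0].
Proof.
move=> b1 c0 kl Ml KLM pK pj0; apply: contrapT => nex.
have {nex}van r s : (r < L + M)%N -> (s < M)%N ->
    \sum_j (p j).[(l * r + k * s)%:R] * ((b ^ r * c ^ s)%:R) ^+ j = 0.
  move=> rL sM; apply/eqP; apply: contrapT => /negP h.
  by apply: nex; exists r, s.
(* Replacing the zero p_j by 1 keeps the Vandermonde determinant complete; the
   kernel vector used below is 0 at these indices. *)
pose q j := if p j == 0 then 1 else p j.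
have q0 j : q j != 0 by rewrite /q; case: (eqVneq (p j) 0) => // _; exact: oner_neq0.
pose G : 'M[{poly F}]_L := \matrix_(j, i)
  ((q j \Po ('X + (l * i)%:R%:P)) * ((b ^ j)%:R ^+ i)%:P).
have bpow0 (i j : nat) : ((b ^ j)%:R ^+ i : F) != 0.
  by rewrite expf_neq0 // pnatr_eq0 expn_eq0 negb_and -lt0n (ltnW b1).
have G0 j i : G j i != 0.
  rewrite mxE mulf_neq0 ?polyC_eq0 //.
  by rewrite -size_poly_gt0 size_comp_poly2 ?size_XaddC ?size_poly_gt0.
have Gsz j i : size (G j i) = size (q j).
  by rewrite mxE mulrC size_Cmul // size_comp_poly2 // size_XaddC.
have Glead j i : lead_coef (G j i) = lead_coef (q j) * (b ^ j)%:R ^+ i.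
  rewrite mxE lead_coefM lead_coefC lead_coef_comp ?size_XaddC //.
  by rewrite lead_coefXaddC expr1n mulr1.
pose dg := (\sum_j (size (q j)).-1)%N.
have Pcoef (s : 'S_L) : (\prod_j G j (s j))`_dg =
    \prod_j (lead_coef (q j) * (b ^ j)%:R ^+ s j).
  under [RHS]eq_bigr => j _ do rewrite -Glead.
  rewrite -lead_coef_prod lead_coefE size_prod => [|j _]; last exact: G0.
  congr (_`_ _); rewrite /dg.
  have -> : (\sum_j size (G j (s j)) = \sum_j (size (q j)).-1 + #|'I_L|)%N.
    rewrite -sum1_card -big_split /=; apply: eq_bigr => j _.
    by rewrite Gsz addn1 prednK // size_poly_gt0.
  by rewrite -addSn addnK.
have Psize (s : 'S_L) : (size (\prod_j G j (s j))%R <= dg.+1)%N.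
  rewrite size_prod => [|j _]; last exact: G0.
  rewrite leq_subLR /dg addnS ltnS addnC -sum1_card -big_split /=.
  by apply: leq_sum => j _; rewrite Gsz addn1 prednK ?size_poly_gt0.
have detG0 : \det G != 0.
  suff : (\det G)`_dg != 0.
    by apply: contraNneq => ->; rewrite coef0.
  rewrite coef_sum.
  have -> : \sum_(s : 'S_L) ((-1) ^+ s * \prod_j G j (s j))`_dg =
     (\prod_j lead_coef (q j)) * \det (Vandermonde L (\row_j (b ^ j)%:R)).
    rewrite -[\det (Vandermonde _ _)]det_tr big_distrr /=.
    apply: eq_bigr => s _.
    have -> : (-1) ^+ s = ((-1) ^+ s)%:P :> {poly F}.
      by case: (odd_perm s); rewrite ?expr0 ?expr1 ?polyCN.
    rewrite coefCM Pcoef big_split /= mulrCA; congr (_ * (_ * _)).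
    by apply: eq_bigr => j _; rewrite !mxE.
  rewrite det_Vandermonde mulf_neq0 //.
    by apply/prodf_neq0 => j _; rewrite lead_coef_eq0.
  apply/prodf_neq0 => i _; apply/prodf_neq0 => j ij.
  by rewrite !mxE subr_eq0 eqr_nat eqn_exp2l // gtn_eqF.
have K0 : (0 < K)%N.
  by apply: leq_trans (pK j0); rewrite size_poly_gt0.
have qK j : (size (q j) <= K)%N.
  by rewrite /q; case: eqP => // _; rewrite size_poly1.
have detGsz : (size (\det G) <= (K.-1 * L).+1)%N.
  apply: leq_trans (size_sum _ _ _) _; apply/bigmax_leqP => s _.
  have -> : size ((-1) ^+ s * \prod_j G j (s j)) = size (\prod_j G j (s j)).
    by case: (odd_perm s); rewrite ?mul1r // expr1 mulN1r size_polyN.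
  apply: leq_trans (Psize s) _; rewrite ltnS /dg mulnC.
  rewrite -[L in (L * _)%N]card_ord -sum_nat_const.
  by apply: leq_sum => j _; rewrite -ltnS !prednK ?size_poly_gt0.
pose xs := [seq ((l * rs.1 + k * rs.2)%:R : F) | rs : 'I_M * 'I_M].
have xsroot : all (root (\det G)) xs.
  apply/allP => x /mapP [[r s] _ ->] /=.
  set y := (l * r + k * s)%:R : F.
  rewrite /root -[(\det G).[y]]/(horner_eval y (\det G)) -det_map_mx.
  apply/det0P; exists (\row_j if p j == 0 then 0 else (b ^ r * c ^ s)%:R ^+ j).
    apply/eqP => /rowP /(_ j0); rewrite !mxE (negPf pj0) => /eqP.
    by rewrite expf_eq0 pnatr_eq0 muln_eq0 !expn_eq0 !(gtn_eqF (ltnW b1), gtn_eqF c0) !andbF.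
  apply/rowP => i; rewrite !mxE -[RHS](@van (i + r)%N s) //; last first.
    by rewrite -addSn leq_add // ltnW.
  apply: eq_bigr => j _; rewrite !mxE /= /q.
  case: eqP => [->|_]; first by rewrite mul0r horner0 mul0r.
  rewrite /horner_eval hornerM hornerC horner_comp !hornerE /y.
  rewrite /= -mulrA mulrCA; congr (_ * _); last first.
    rewrite [RHS](_ : _ = (b ^ i)%:R ^+ j * (b ^ r * c ^ s)%:R ^+ j); last first.
      by rewrite -exprMn -natrM expnD mulnA.
    rewrite mulrC; congr (_ * _).
    by rewrite !natrX -!exprM mulnC.
  by congr (_.[_]); rewrite -natrD; congr _%:R; nia.
(* Coprimality of k and l and M <= l make the abscissas l r + k s distinct. *)
have xsuniq : uniq xs.
  rewrite map_inj_uniq ?enum_uniq // => -[r s] [r' s'] /= /eqP.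
  rewrite eqr_nat => /eqP e.
  have ss : s = s' :> nat.
    have : (k * s = k * s' %[mod l])%N.
      by rewrite -(modnMDl r (k * s)) -(modnMDl r' (k * s')) ![(_ * l)%N]mulnC e.
    wlog sle : r s r' s' e / (s <= s')%N.
      move=> h; case/orP: (leq_total s s') => ?; first exact: (h r s r' s').
      by move/esym => ?; apply/esym; apply: (h r' s' r s).
    move/esym/eqP; rewrite eqn_mod_dvd ?leq_mul // -mulnBr Gauss_dvdr; last first.
      by rewrite coprime_sym.
    have sl : (s' < l)%N by apply: leq_trans Ml.
    have [|] := posnP (s' - s)%N; first by move=> ? _; lia.
    by move=> ? /dvdn_leq; lia.
  have rr : r = r' :> nat.
    move: e; rewrite ss => /addIn /eqP; rewrite eqn_pmul2l; first by move/eqP.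
    by apply: leq_trans Ml; case: {+}M r => [[]|].
  by rewrite (val_inj ss) (val_inj rr).
have := max_poly_roots detG0 xsroot xsuniq.
rewrite size_map -cardE card_prod !card_ord => h.
by have := leq_trans h detGsz; rewrite ltnS leqNgt KLM.
Qed.

Lemma exists_nonzero_minor (F : fieldType) (I J : finType) (g : I -> J -> F) :
  (forall v : I -> F, (exists i, v i != 0) ->
     exists j, \sum_i v i * g i j != 0) ->
  exists h : 'I_#|I| -> J,
    \det (\matrix_(i, j) g (enum_val i) (h j)) != 0.
Proof.
move=> indep.
pose A := \matrix_(i < #|I|, j < #|J|) g (enum_val i) (enum_val j).
have Afree : row_free A.
  apply: inj_row_free => v vA; apply/rowP => i0; rewrite mxE; apply/eqP.
  apply: contrapT => /negP vi0.
  have [|j] := indep (fun i => v 0 (enum_rank i)).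
    by exists (enum_val i0); rewrite enum_valK.
  move/eqP; apply; have /rowP/(_ (enum_rank j)) := vA; rewrite !mxE => {2}<-.
  rewrite (reindex enum_rank); last exact: onW_bij (enum_rank_bij _).
  by apply: eq_bigr => i _; rewrite !mxE !enum_rankK.
have Afull : row_full A^T by rewrite /row_full mxrank_tr.
exists (fun j => enum_val (fullrankfun Afull j)).
have := fullrowsub_unit Afull; rewrite unitmxE unitfE -det_tr.
suff -> : (rowsub (fullrankfun Afull) A^T)^T =
  \matrix_(i, j) g (enum_val i) (enum_val (fullrankfun Afull j)) by [].
by apply/matrixP => i j; rewrite !mxE.
Qed.

Lemma nat_det_ge1 (F : realFieldType) (n : nat) (A : 'M[nat]_n) :
  \det (\matrix_(i, j) (A i j)%:R : 'M[F]_n) != 0 ->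
  1 <= `|\det (\matrix_(i, j) (A i j)%:R : 'M[F]_n)|.
Proof.
have -> : (\matrix_(i, j) (A i j)%:R : 'M[F]_n) =
    map_mx intr (\matrix_(i, j) ((A i j)%:R : int)).
  by apply/matrixP => i j; rewrite !mxE mulrz_nat.
rewrite det_map_mx intr_eq0 => h.
by rewrite -intr_norm -[1]/(1%:~R) ler_int -gtz0_ge1 normr_gt0.
Qed.

(** Integrality enters here: the zero estimate says that the rows are linearly
    independent, so some maximal minor is nonzero, and it is an integer. *)
Lemma powers_nonzero_minor (F : realFieldType) (b c k l K L M : nat) :
  (1 < b)%N -> (0 < c)%N -> coprime k l -> (M <= l)%N -> (K.-1 * L < M * M)%N ->
  exists h : 'I_#|{: 'I_K * 'I_L}| -> 'I_(L + M) * 'I_M,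
    let ij : 'I_#|{: 'I_K * 'I_L}| -> 'I_K * 'I_L := enum_val in
    1 <= `|\det (\matrix_(i, j)
      ((l * (h j).1 + k * (h j).2)%:R ^+ (ij i).1
       * (b ^ (h j).1 * c ^ (h j).2)%:R ^+ (ij i).2) : 'M[F]_ _)|.
Proof.
move=> b1 c0 kl Ml KLM.
have [v [[i0 j0] v0]|h hdet] := @exists_nonzero_minor F _ _
   (fun (ij : 'I_K * 'I_L) (rs : 'I_(L + M) * 'I_M) =>
     (l * rs.1 + k * rs.2)%:R ^+ ij.1 * (b ^ rs.1 * c ^ rs.2)%:R ^+ ij.2).
  pose p (j : 'I_L) : {poly F} := rVpoly (\row_i v (i, j)).
  have pE j x : (p j).[x] = \sum_i v (i, j) * x ^+ i.
    rewrite horner_poly; apply: eq_bigr => i _.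
    by rewrite valK mxE.
  have pj0 : p j0 != 0.
    apply: contraNneq v0 => /(congr1 (fun q : {poly F} => q`_i0)).
    by rewrite coef_rVpoly_ord mxE coef0 => ->.
  have [|r [s [rL sM]]] := @zero_estimate F b c k l K L M p j0 b1 c0 kl Ml KLM _ pj0.
    by move=> j; exact: size_poly.
  move=> h; exists (Ordinal rL, Ordinal sM); move: h.
  under eq_bigr => j _ do rewrite pE mulr_suml.
  rewrite exchange_big pair_big /=; congr (_ != 0); apply: eq_bigr => -[i j] _ /=.
  by rewrite mulrA.
exists h => ij; pose A : 'M[nat]_(#|{: 'I_K * 'I_L}|) := \matrix_(i, j)
   ((l * (h j).1 + k * (h j).2) ^ (ij i).1
    * (b ^ (h j).1 * c ^ (h j).2) ^ (ij i).2)%N.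
set B := (X in \det X); have := @nat_det_ge1 F _ A.
have -> : (\matrix_(i, j) (A i j)%:R : 'M[F]_ _) = B.
  by apply/matrixP => i j; rewrite !mxE natrM !natrX.
exact.
Qed.

(** * Interpolation determinants of exponential polynomials *)

Lemma cvg_det (R : realType) (n : nat) (A : nat -> 'M[R]_n) (B : 'M[R]_n) :
  (forall i j, A m i j @[m --> \oo] --> B i j) ->
  \det (A m) @[m --> \oo] --> \det B.
Proof.
move=> AB; rewrite /determinant.
apply: cvg_big => [|s _]; first exact: add_continuous.
apply: cvgM; first exact: cvg_cst.
by apply: cvg_big => //; exact: mul_continuous.
Qed.

(** The coefficients of the power series of x ^+ u * expR (w * x). *)
Definition xexp_coeff (R : realType) (u : nat) (w : R) (k : nat) : R :=
  if (u <= k)%N then w ^+ (k - u) / (k - u)`!%:R else 0.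

Lemma xexp_partial_sum (R : realType) (u m : nat) (w x : R) :
  \sum_(k < m) xexp_coeff u w k * x ^+ k =
  x ^+ u * series (exp_coeff (w * x)) (m - u)%N.
Proof.
rewrite /series /= mulr_sumr -(big_mkord xpredT (fun k => xexp_coeff u w k * x ^+ k)).
have [um|mu] := leqP u m; last first.
  rewrite (_ : (m - u = 0)%N) ?[RHS]big_geq //; last by lia.
  rewrite big_nat big1 // => k km; rewrite /xexp_coeff.
  by rewrite leqNgt (leq_ltn_trans _ mu) ?mul0r //; lia.
rewrite (big_cat_nat (n := u)) //= big_nat big1 ?add0r; last first.
  by move=> k /andP[_ ku]; rewrite /xexp_coeff leqNgt ku mul0r.
rewrite -[X in \sum_(X <= _ < m) _]add0n big_addn.
apply: eq_bigr => k _; rewrite /xexp_coeff leq_addl addnK /exp_coeff /=.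
by rewrite exprMn exprD; ring.
Qed.

Lemma xexp_partial_sum_cvg (R : realType) (u : nat) (w x : R) :
  \sum_(k < m) xexp_coeff u w k * x ^+ k @[m --> \oo]
  --> x ^+ u * expR (w * x).
Proof.
under eq_fun do rewrite xexp_partial_sum.
apply: cvgM; first exact: cvg_cst.
by have := is_cvg_series_exp_coeff (w * x); rewrite -(cvg_centern u).
Qed.

Lemma xexp_partial_sum_le (R : realType) (u m : nat) (w x : R) :
  0 <= w -> 0 <= x ->
  \sum_(k < m) xexp_coeff u w k * x ^+ k <= x ^+ u * expR (w * x).
Proof.
move=> w0 x0; rewrite xexp_partial_sum ler_wpM2l ?exprn_ge0 //.
apply: nondecreasing_cvgn_le; last exact: is_cvg_series_exp_coeff.
by apply: nondecreasing_series => k _ _; rewrite exp_coeff_ge0 // mulr_ge0.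
Qed.

(** The series of x ^+ u * expR (w * x) has nonnegative coefficients, so its
    partial sums at E * T are at most its value there, and the bound for polynomial
    rows passes to the limit. *)
Lemma det_exp_rows_le (R : realType) (n : nat) (u : 'I_n -> nat) (w x : 'I_n -> R)
    (T E : R) :
  (forall i, 0 <= w i) -> (forall j, 0 <= x j <= T) -> 1 <= E ->
  `|\det (\matrix_(i, j) (x j ^+ u i * expR (w i * x j)))| * E ^+ 'C(n, 2)
   <= n`!%:R * \prod_i ((E * T) ^+ u i * expR (w i * (E * T))).
Proof.
case: n u w x => [|n] u w x w0 xT E1.
  by rewrite det_mx00 big_ord0 bin0n expr0 fact0 normr1.
have T0 : 0 <= E * T.
  rewrite mulr_ge0 ?(le_trans _ E1) //.
  by have /andP[a b] := xT ord0; exact: le_trans b.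
pose P m : 'M[R]_n.+1 := \matrix_(i, j) \sum_(k < m) xexp_coeff (u i) (w i) k * x j ^+ k.
set A := \matrix_(i, j) _.
have PA : `|\det (P m)| * E ^+ 'C(n.+1, 2) @[m --> \oo] -->
    `|\det A| * E ^+ 'C(n.+1, 2).
  apply: cvgM; last exact: cvg_cst.
  apply: cvg_norm; apply: cvg_det => i j; rewrite mxE.
  under eq_fun do rewrite mxE.
  exact: xexp_partial_sum_cvg.
apply: (cvgr_to_le PA); apply: nearW => m.
have C0 i k : 0 <= xexp_coeff (u i) (w i) k.
  by rewrite /xexp_coeff; case: ifP => // _; rewrite divr_ge0 // exprn_ge0.
apply: le_trans (@det_power_rows_le _ n.+1 m _ _ T E _ xT E1) _ => [i k|].
  exact: C0.
rewrite ler_wpM2l // ler_prod // => i _; apply/andP; split.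
  by apply: sumr_ge0 => k _; rewrite mulr_ge0 // exprn_ge0.
exact: xexp_partial_sum_le.
Qed.

Lemma norm_expR_sub1_le (R : realType) (v : R) :
  `|v| <= 1 / 2 -> `|expR v - 1| <= 2 * `|v|.
Proof.
move=> v2; have h1 := expR_ge1Dx v; have h2 := expR_ge1Dx (- v).
have e0 := expR_gt0 v; have e1 : expR v * expR (- v) = 1 by rewrite expRxMexpNx_1.
have [v0|v0] := leP 0 v; rewrite ?(ger0_norm v0) ?(ltr0_norm v0) in v2 *.
  rewrite ger0_norm; last by lra.
  have : expR v * (1 - v) <= 1 by rewrite -e1 ler_pM2l // addrC; lra.
  nra.
by rewrite ler_norml; apply/andP; split; [lra|]; have : expR v < 1; [rewrite expR_lt1|lra].
Qed.

(** Write Lam = k ln b - l ln c, w = ln b / l and x = l r + k s.  Then b ^ r c ^ s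
    equals expR (w x) up to the factor expR (- s Lam / l), which is close to 1.  So
    the integer minor of [powers_nonzero_minor], which is at least 1, differs
    little from a determinant to which [det_exp_rows_le] applies.  The first summand
    below comes from the latter, the second one from the perturbation. *)
Lemma linear_form_interpolation (R : realType) (b c k l K L M T E N : nat)
    (e Q : R) :
  (1 < b)%N -> (1 < c)%N -> coprime k l -> (M <= l)%N -> (K.-1 * L < M * M)%N ->
  (l * (L + M) + k * M <= l * T)%N -> (M <= T)%N -> (0 < E)%N ->
  `|k%:R * ln (b%:R : R) - l%:R * ln c%:R| <= e -> L%:R * e <= 1 / 2 ->
  N = (K * L)%N -> Q = ((l * T) ^ K * (b * c) ^ (T * L))%:R ->
  1 <= N`!%:R * (((E * (l * T)) ^ K * b ^ (E * T * L))%:R ^+ N / E%:R ^+ 'C(N, 2)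
                 + N%:R * (2 * Q) ^+ N * (2 * L%:R * e * Q)).
Proof.
move=> b1 c1 kl Ml KLM lT MT E0 Lam Le NE QE.
have N_card : #|{: 'I_K * 'I_L}| = N by rewrite card_prod !card_ord NE.
have [h] := powers_nonzero_minor R b1 (ltnW c1) kl Ml KLM.
move=> /=; rewrite -!N_card.
set n := #|_|; set A := \matrix_(i, j) _ => detA.
have M0 : (0 < M)%N by case: (M) KLM => //; rewrite mul0n.
have l0 : (0 < l)%N by exact: leq_trans Ml.
have T0 : (0 < T)%N by exact: leq_trans MT.
have lR : 0 < l%:R :> R by rewrite ltr0n.
have bR : 0 < b%:R :> R by rewrite ltr0n ltnW.
have cR : 0 < c%:R :> R by rewrite ltr0n ltnW.
set Lm : R := _ - _ in Lam.
pose w : R := ln b%:R / l%:R.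
have w0 : 0 <= w by rewrite divr_ge0 // ln_ge0 // ler1n ltnW.
pose x (j : 'I_n) : R := (l * (h j).1 + k * (h j).2)%:R.
pose y (j : 'I_n) : R := (b ^ (h j).1 * c ^ (h j).2)%:R.
pose u (i : 'I_n) : 'I_K * 'I_L := enum_val i.
have AE i j : A i j = x j ^+ (u i).1 * y j ^+ (u i).2 by rewrite mxE.
have rlt j : ((h j).1 < L + M)%N by exact: ltn_ord.
have slt j : ((h j).2 < M)%N by exact: ltn_ord.
have xT j : 0 <= x j <= (l * T)%:R.
  rewrite ler0n ler_nat (leq_trans _ lT) // leq_add // leq_mul //.
    by rewrite ltnW.
  by rewrite ltnW.
have LMT : (L + M <= T)%N.
  by rewrite -(leq_pmul2l l0) (leq_trans _ lT) // leq_addr.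
have yQ j : 0 < y j <= ((b * c) ^ T)%:R.
  rewrite ltr0n muln_gt0 !expn_gt0 (ltnW b1) (ltnW c1) /= ler_nat expnMn.
  by rewrite leq_mul // leq_exp2l // ltnW // (leq_trans _ LMT) // (leq_trans (slt j)) ?leq_addl.
pose v i j : R := (u i).2%:R * (h j).2%:R * Lm / l%:R.
have vle i j : `|v i j| <= L%:R * e.
  rewrite /v !normrM !normr_nat normfV normr_nat.
  rewrite ler_pdivrMr // [leRHS]mulrAC -!natrM ler_pM //.
  rewrite ler_nat leq_mul //; first exact: ltnW.
  exact: leq_trans (ltnW (slt j)) Ml.
(* y = expR (w x - s Lam / l), so that v is the error in the exponent of y ^ j. *)
have fE i j : x j ^+ (u i).1 * expR ((u i).2%:R * w * x j) = A i j * expR (v i j).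
  rewrite AE -[RHS]mulrA; congr (_ * _).
  have [y0 _] := andP (yQ j).
  rewrite -[y j]lnK ?posrE // -expRM_natl -expRD; congr expR.
  rewrite /y /v /w /x natrM !natrX lnM ?posrE ?exprn_gt0 // !lnXn //.
  rewrite -(mulr_natl (ln b%:R)) -(mulr_natl (ln c%:R)) /Lm !natrD !natrM; field.
  by rewrite gt_eqF.
have Q1 : 1 <= Q.
  by rewrite QE ler1n muln_gt0 !expn_gt0 !muln_gt0 l0 T0 (ltnW b1) (ltnW c1).
have AQ i j : 0 <= A i j <= Q.
  have /andP[x0 xl] := xT j; have /andP[y0 yl] := yQ j.
  rewrite AE mulr_ge0 ?exprn_ge0 ?(ltW y0) //= QE natrM ler_pM ?exprn_ge0 ?(ltW y0) //.
    apply: le_trans (_ : (l * T)%:R ^+ (u i).1 <= _).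
      by rewrite lerXn2r ?nnegrE.
    by rewrite natrX ler_weXn2l ?ler1n ?muln_gt0 ?l0 // ltnW.
  apply: le_trans (_ : ((b * c) ^ T)%:R ^+ (u i).2 <= _).
    by rewrite lerXn2r ?nnegrE // ltW.
  rewrite expnM [in leRHS]natrX ler_weXn2l ?ler1n ?expn_gt0 ?muln_gt0 ?(ltnW b1) ?(ltnW c1) //.
  by rewrite ltnW.
pose f : 'M[R]_n := \matrix_(i, j) (x j ^+ (u i).1 * expR ((u i).2%:R * w * x j)).
have ev i j : `|expR (v i j) - 1| <= 2 * L%:R * e.
  apply: le_trans (norm_expR_sub1_le (le_trans (vle i j) Le)) _.
  by rewrite -mulrA ler_wpM2l.
have Af i j : `|A i j - f i j| <= 2 * L%:R * e * Q.
  have /andP[a0 aQ] := AQ i j.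
  rewrite [f i j]mxE fE -{1}[A i j]mulr1 -mulrBr normrM mulrC distrC.
  by rewrite ler_pM // ger0_norm.
have fQ i j : `|f i j| <= 2 * Q.
  have /andP[a0 aQ] := AQ i j.
  rewrite [f i j]mxE fE normrM mulrC (ger0_norm a0) (gtr0_norm (expR_gt0 _)).
  rewrite ler_pM ?expR_ge0 //.
  have := ev i j; rewrite ler_norml => /andP[_].
  by move: Le; lra.
have detAf := @det_dist_le _ n A f (2 * Q) _ _ _ fQ Af.
have {detAf}detAf : `|\det A - \det f| <= n`!%:R * (n%:R * (2 * Q) ^+ n * (2 * L%:R * e * Q)).
  apply: detAf; first by lra.
  by move=> i j; have /andP[a0 aQ] := AQ i j; rewrite ger0_norm //; lra.
have detf := @det_exp_rows_le R n (fun i => (u i).1) (fun i => (u i).2%:R * w) x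
  (l * T)%:R E%:R (fun i => mulr_ge0 (ler0n _ _) w0) xT.
rewrite ler1n in detf; have {}detf := detf E0.
rewrite mulrDr; apply: le_trans detA _.
rewrite -[\det A](subrK (\det f)) addrC; apply: le_trans (ler_normD _ _) _.
apply: lerD => //.
rewrite mulrA ler_pdivlMr; last by rewrite exprn_gt0 // ltr0n.
apply: le_trans detf _; rewrite ler_wpM2l //.
rewrite -[n in _ ^+ n]card_ord -prodr_const ler_prod // => i _.
rewrite mulr_ge0 ?exprn_ge0 ?mulr_ge0 ?expR_ge0 //=.
rewrite [X in _ <= X]natrM ler_pM ?exprn_ge0 ?mulr_ge0 ?expR_ge0 //.
  by rewrite -natrM natrX ler_weXn2l ?ler1n ?muln_gt0 ?E0 ?l0 // ltnW.
have -> : (u i).2%:R * w * (E%:R * (l * T)%:R) = ((u i).2 * (E * T))%:R * ln (b%:R : R).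
  by rewrite /w !natrM; field; rewrite gt_eqF.
rewrite expRM_natl lnK ?posrE // natrX ler_weXn2l ?ler1n ?(ltnW b1) //.
by rewrite mulnC leq_mul // ltnW.
Qed.

(** * Linear forms in two logarithms and gaps between powers *)

Lemma monomial_le_exp2 (A d : nat) :
  exists n0, forall n, (n0 <= n -> A * n ^ d <= 2 ^ n)%N.
Proof.
elim: d A => [|d IH] A.
  exists A => n An; rewrite expn0 muln1; apply: leq_trans An _.
  exact/ltnW/ltn_expl.
have [n0 hn0] := IH (A * 3 ^ d.+1)%N.
exists (n0.*2 + 2)%N => n nn0; pose h := n./2.
have nE := odd_double_half n; rewrite -/h in nE.
have h1 : (n0 <= h)%N by rewrite -leq_double; lia.
have n3 : (n <= 3 * h)%N by lia.
apply: (@leq_trans (A * (3 * h) ^ d.+1)); first by rewrite leq_mul // leq_exp2r.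
rewrite expnMn mulnA [(h ^ d.+1)%N]expnSr mulnA.
apply: (@leq_trans (2 ^ h * 2 ^ h)).
  by rewrite leq_mul ?hn0 // ltnW // ltn_expl.
by rewrite -expnD leq_exp2l //; lia.
Qed.

Lemma leq_fact_expn (n : nat) : (n`! <= n ^ n)%N.
Proof.
rewrite fact_prod -[X in (_ <= _ ^ X)%N](subn1 n.+1) -prod_nat_const_nat big_nat.
by rewrite [leqRHS]big_nat; apply: leq_prod => i /andP[].
Qed.

Lemma expr_ge_exp2 (R : archiRealFieldType) (rho : R) :
  1 < rho -> exists2 h, (0 < h)%N & forall l D, (h * D <= l)%N -> 2 ^+ D <= rho ^+ l.
Proof.
move=> rho1.
have [h0 h0P] : exists h : nat, (rho - 1)^-1 <= h%:R.
  by exists (Num.truncn (rho - 1)^-1).+1; rewrite ltW // truncnS_gt.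
have r0 : 0 < rho - 1 by rewrite subr_gt0.
exists h0.+1 => // l D hl.
have two : 2 <= rho ^+ h0.+1.
  have bern n : 1 + n%:R * (rho - 1) <= rho ^+ n.
    elim: n => [|n IH]; first by rewrite mul0r addr0 expr0.
    rewrite exprS -natr1.
    have : rho * (1 + n%:R * (rho - 1)) <= rho * rho ^+ n by rewrite ler_pM2l //; lra.
    have : 0 <= n%:R * (rho - 1) * (rho - 1) by rewrite !mulr_ge0 // ltW.
    nra.
  apply: le_trans (bern _); rewrite -natr1.
  have : 1 <= h0%:R * (rho - 1) by rewrite -ler_pdivrMr // mul1r.
  nra.
apply: (@le_trans _ _ (rho ^+ (h0.+1 * D))).
  by rewrite exprM lerXn2r ?nnegrE ?exprn_ge0 //; lra.
by rewrite ler_weXn2l // ltW.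
Qed.

Lemma eight_bin2 (n : nat) : (8 * 'C(n, 2) = n * (4 * n.-1))%N.
Proof. by have := mul_bin_diag n 1; rewrite bin1; lia. Qed.

(** Compares the exponents of 2 in the analytic bound N`! B ^ N for the minor and
    in E ^ 'C(N, 2), divided by N, for N = m ^ 2 L ^ 2, K = m ^ 2 L and E = 2 ^ 8; the quadratic term on the left
    has coefficient 3 m ^ 2, against 4 m ^ 2 on the right. *)
Lemma main_exponent_le (m g L : nat) : (0 < m)%N -> (10 <= L)%N -> (g <= m)%N ->
  (L + (8 + 2 * L) * (m * m * L) + g * m * L * L + 2 <= 4 * (m * m * L * L).-1)%N.
Proof.
move=> m0 L10 gm.
have h1 : (g * m * L * L <= m * m * (L * L))%N by rewrite -mulnA !leq_mul.
have h2 : (L * 10 <= L * L)%N by rewrite leq_mul.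
have h3 : (1 <= m * m)%N by rewrite muln_gt0 m0.
have h4 : (L <= m * m * L)%N by rewrite leq_pmull.
have h5 : (m * m * (L * 10) <= m * m * (L * L))%N by rewrite leq_mul.
have e1 : (m * m * L * L = m * m * (L * L))%N by rewrite -mulnA.
have e2 : ((8 + 2 * L) * (m * m * L) = 8 * (m * m * L) + 2 * (m * m * (L * L)))%N.
  by rewrite mulnDl; congr (_ + _)%N; rewrite -[LHS]mulnA; congr (2 * _)%N; rewrite mulnC -!mulnA.
rewrite e1 e2; move: h5; rewrite mulnA [(_ * 10)%N]mulnC.
move: h1 h4 L10; move: (m * m * (L * L))%N (m * m * L)%N (g * m * L * L)%N; lia.
Qed.

(** The left-hand side is the exponent of 2 in the perturbation term; a power of
    L suffices because l is exponential in L. *)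
Lemma perturbation_exponent_le (m C L : nat) : (0 < m)%N -> (0 < L)%N ->
  (L * (m * m * L * L) + L + (C * L * L + 1) * (m * m * L * L)
     + (1 + L + C * L * L) + 2
   <= (m * m * (C + 2) + C + 5) * L ^ 4)%N.
Proof.
move=> m0 L0.
have e : (L ^ 4 = L * L * L * L)%N by rewrite !expnS expn0 muln1 !mulnA.
have a1 : (1 <= L)%N by [].
have a2 : (L * 1 <= L * L)%N by rewrite leq_mul.
have a3 : (L * L * 1 <= L * L * L)%N by rewrite leq_mul.
have a4 : (L * L * L * 1 <= L * L * L * L)%N by rewrite leq_mul.
rewrite e; move: a2 a3 a4; rewrite !muln1.
move e2 : (L * L)%N => L2; move e3 : (L2 * L)%N => L3; move e4 : (L3 * L)%N => L4.
move=> l2 l3 l4.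
have -> : (L * (m * m * L * L) = m * m * L3)%N by rewrite -e3 -e2; ring.
have -> : ((C * L * L + 1) * (m * m * L * L) = m * m * C * L4 + m * m * L2)%N.
  by rewrite -e4 -e3 -e2; ring.
have -> : (C * L * L = C * L2)%N by rewrite -e2; ring.
have k1 : (m * m * L3 <= m * m * L4)%N by rewrite leq_mul.
have k2 : (m * m * L2 <= m * m * L4)%N by rewrite leq_mul // (leq_trans l3).
have k3 : (C * L2 <= C * L4)%N by rewrite leq_mul // (leq_trans l3).
have -> : ((m * m * (C + 2) + C + 5) * L4 =
  m * m * C * L4 + m * m * L4 + m * m * L4 + C * L4 + 5 * L4)%N by ring.
lia.
Qed.

(** The parameters of [linear_form_interpolation] grow like powers of L, the
    number of binary digits of l: M = m L, K = m ^ 2 L, hence K L = M ^ 2 as the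
    zero estimate wants, and T = (kap + 2) m L bounds the abscissas divided by l.
    The constant m is large enough for E ^ 'C(N, 2), of binary logarithm about
    4 m ^ 4 L ^ 4, to beat all the other factors of the main term.  The perturbation
    is at most 2 ^ (D L ^ 4) rho ^ (- l), and l >= 2 ^ (L - 1). *)
Lemma coprime_linear_form_ge (R : realType) (b c kap : nat) (rho : R) :
  (1 < b)%N -> (1 < c)%N -> 1 < rho ->
  exists l0, forall k l, (l0 <= l)%N -> coprime k l -> (k <= kap * l)%N ->
    (rho ^+ l)^-1 < `|k%:R * ln (b%:R : R) - l%:R * ln c%:R|.
Proof.
move=> b1 c1 rho1.
have [h h0 hP] := expr_ge_exp2 rho1.
(* This m makes the contribution of b ^ (E T L) equal to m ^ 2 L ^ 2. *)
pose m := (2 ^ 8 * b * (kap + 2))%N.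
have m0 : (0 < m)%N by rewrite !muln_gt0 addn_gt0 (ltnW b1) orbT.
have mE : m = (2 ^ 8 * b * (kap + 2))%N by [].
clearbody m.
pose C := (2 * (m * m) + b * c * (kap + 2) * m)%N.
pose D := (m * m * (C + 2) + C + 5)%N.
have [L1 hL1] := monomial_le_exp2 (m * m) 2.
have [L2 hL2] := monomial_le_exp2 ((kap + 2) * m) 1.
have [L3 hL3] := monomial_le_exp2 (2 * (h * D)) 4.
exists (2 ^ (L1 + L2 + L3 + 10))%N => k l l0l kl kk.
have lpos : (0 < l)%N by apply: leq_trans l0l; rewrite expn_gt0.
have /andP[Ll lL] := trunc_log_bounds (ltnSn 1) lpos.
have L0L : (L1 + L2 + L3 + 10 <= trunc_log 2 l)%N by exact: trunc_log_max.
move: Ll lL L0L; move: (trunc_log 2 l) => t Ll lL L0L.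
pose L := t.+1.
have LL : (L1 + L2 + L3 + 10 <= L)%N by rewrite ltnW.
have NL : (m * m * L * L <= 2 ^ L)%N by rewrite -[X in (X <= _)%N]mulnA (mulnn L) hL1 //; lia.
have TL : ((kap + 2) * m * L <= 2 ^ L)%N.
  by have := hL2 L; rewrite expn1; apply; lia.
have hl : (h * (D * L ^ 4) <= l)%N.
  apply: leq_trans Ll; rewrite -(leq_pmul2l (ltn0Sn 1)) -expnS.
  rewrite (_ : _ * _ = 2 * (h * D) * L ^ 4)%N ?hL3 //; first lia.
  by ring.
have L0 : (0 < L)%N by [].
have ML : (m * L <= l)%N.
  apply: leq_trans hl; rewrite mulnA leq_mul //.
    apply: (@leq_trans D); last by rewrite leq_pmull.
    rewrite /D /C; nia.
  by have := leq_pexp2l L0 (isT : (1 <= 4)%N); rewrite expn1.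
rewrite ltNge; apply/negP => Lam.
pose T := ((kap + 2) * m * L)%N.
pose K := (m * m * L)%N; pose N := (K * L)%N.
have K0 : (0 < K)%N by rewrite !muln_gt0 m0.
have rho0 : 0 < rho by lra.
have rl0 : 0 < rho ^+ l by rewrite exprn_gt0.
have big D' : (D' <= D * L ^ 4)%N -> 2 ^+ D' <= rho ^+ l.
  by move=> DD; apply: hP; apply: leq_trans hl; rewrite leq_mul.
have pert := perturbation_exponent_le C m0 L0.
have c_1 : (K.-1 * L < m * L * (m * L))%N.
  rewrite (_ : (m * L * (m * L) = K * L)%N) ?ltn_pmul2r ?ltn_predL //.
  by rewrite /K; ring.
have c_2 : (l * (L + m * L) + k * (m * L) <= l * T)%N.
  apply: (@leq_trans (l * (m * L + m * L) + kap * l * (m * L))).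
    by rewrite leq_add ?leq_mul // leq_add2r leq_pmull.
  by apply: eq_leq; rewrite /T; ring.
have c_3 : (m * L <= T)%N by rewrite /T -mulnA leq_pmull // addn2.
have c_4 : L%:R * (rho ^+ l)^-1 <= 1 / 2.
  have : 2 * L%:R <= rho ^+ l.
    apply: le_trans (big L.+1 _); last by apply: leq_trans pert; lia.
    by rewrite exprS ler_pM2l // -natrX ler_nat ltnW // ltn_expl.
  by rewrite ler_pdivrMr //; lra.
have ineq := @linear_form_interpolation R b c k l K L (m * L) T (2 ^ 8) N
  (rho ^+ l)^-1 _ b1 c1 kl ML c_1 c_2 c_3 isT Lam c_4 erefl erefl.
have NE : N = (m * m * L * L)%N by [].
have lT : (l * T <= 2 ^ (2 * L))%N.
  by rewrite mul2n -addnn expnD leq_mul // ltnW.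
have powle x n : (x ^ n <= 2 ^ (x * n))%N.
  by rewrite expnM; case: n => [//|n]; rewrite leq_exp2r // ltnW // ltn_expl.
have factN : (N`! <= 2 ^ (L * N))%N.
  apply: leq_trans (leq_fact_expn _) _; rewrite expnM.
  by move: NL; rewrite -NE; case: (N) => [//|n] nL; rewrite leq_exp2r.
pose B := ((2 ^ 8 * (l * T)) ^ K * b ^ (2 ^ 8 * T * L))%N.
have BE : (B <= 2 ^ ((8 + 2 * L) * K + m * m * L * L))%N.
  rewrite /B expnD [X in (_ <= X * _)%N]expnM leq_mul //.
    by rewrite leq_exp2r // expnD leq_mul.
  apply: leq_trans (powle _ _) _; rewrite leq_exp2l //.
  apply: eq_leq; rewrite /T; move: (2 ^ 8)%N mE => w8 mE.
  by rewrite [RHS](_ : _ = w8 * b * (kap + 2) * m * L * L)%N; [ring | rewrite -mE].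
have N0 : (0 < N)%N by rewrite muln_gt0 K0.
have L10 : (10 <= L)%N by exact: leq_trans (leq_addl _ _) LL.
have {}BE : (N`! * B ^ N * 4 <= (2 ^ 8) ^ 'C(N, 2))%N.
  have := main_exponent_le m0 L10 (leqnn m); rewrite -/K -NE.
  set X := ((8 + 2 * L) * K)%N => main.
  have BN : (B ^ N <= 2 ^ ((X + m * m * L * L) * N))%N.
    by rewrite expnM leq_exp2r.
  apply: leq_trans (leq_mul (leq_mul factN BN) (leqnn (2 ^ 2))) _.
  rewrite -!expnD -expnM leq_exp2l //.
  rewrite eight_bin2; apply: leq_trans (leq_mul (leqnn N) main).
  by rewrite mulnDr; rewrite -mulnDl mulnC leq_add ?addnA ?leq_pmull.
have QE : ((l * T) ^ K * (b * c) ^ (T * L) <= 2 ^ (C * L * L))%N.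
  apply: (@leq_trans (2 ^ (2 * L * K + b * c * (T * L)))).
    by rewrite expnD [X in (_ <= X * _)%N]expnM leq_mul // leq_exp2r.
  by rewrite leq_exp2l //; apply: eq_leq; rewrite /C /K /T; ring.
move: ineq QE; rewrite -/B.
move: ((l * T) ^ K * (b * c) ^ (T * L))%N => Q ineq QE.
have PE : (N`! * (N * (2 * Q) ^ N) * (2 * L * Q) * 4
    <= 2 ^ (L * (m * m * L * L) + L + (C * L * L + 1) * (m * m * L * L)
     + (1 + L + C * L * L) + 2))%N.
  have h1 : ((2 * Q) ^ N <= 2 ^ ((C * L * L + 1) * N))%N.
    by rewrite expnM leq_exp2r // addn1 expnS leq_mul.
  have h3 : (2 * L * Q <= 2 ^ (1 + L + C * L * L))%N.
    by rewrite 2!expnD leq_mul // leq_mul // ltnW // ltn_expl.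
  have := leq_mul (leq_mul (leq_mul factN (leq_mul NL h1)) h3) (leqnn (2 ^ 2)).
  by rewrite -!expnD !addnA.
have P : N`!%:R * (N%:R * (2 * Q%:R) ^+ N * (2 * L%:R * (rho ^+ l)^-1 * Q%:R)) * 4 <= 1 :> R.
  have -> : N`!%:R * (N%:R * (2 * Q%:R) ^+ N * (2 * L%:R * (rho ^+ l)^-1 * Q%:R)) * 4
    = (N`! * (N * (2 * Q) ^ N) * (2 * L * Q) * 4)%:R / rho ^+ l :> R.
    by rewrite !natrM natrX !natrM; ring.
  rewrite ler_pdivrMr // mul1r; apply: le_trans (big _ pert).
  by rewrite -natrX ler_nat.
have BR : N`!%:R * (B%:R ^+ N / (2 ^ 8)%:R ^+ 'C(N, 2)) * 4 <= 1 :> R.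
  rewrite mulrA mulrAC ler_pdivrMr ?exprn_gt0 // mul1r.
  by rewrite -!natrX -!natrM ler_nat.
by move: ineq P BR; rewrite mulrDr; lra.
Qed.

Lemma ln_le_sub1 (R : realType) (x : R) : 0 < x -> ln x <= x - 1.
Proof. by move=> x0; have := expR_ge1Dx (ln x); rewrite lnK ?posrE //; lra. Qed.

Lemma ln_nat_ge_half (R : realType) (b : nat) : (1 < b)%N -> 1 / 2 <= ln (b%:R : R).
Proof.
move=> b1; have b2 : 2 <= b%:R :> R by rewrite ler_nat.
have := @ln_le_sub1 R (b%:R^-1); rewrite invr_gt0 lnV ?posrE; last by lra.
have : b%:R^-1 <= 1 / 2 :> R by rewrite -[b%:R^-1]mul1r ler_pdivrMr; lra.
move=> h /(_ _) h'; have : 0 < b%:R :> R by lra.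
by move/h'; lra.
Qed.

Lemma finite_gap (R : realFieldType) (I : finType) (f : I -> R) :
  exists2 C : R, 0 < C & forall i, f i != 0 -> C <= `|f i|.
Proof.
have S0 : 0 <= \sum_i `|f i|^-1 by apply: sumr_ge0 => i _; rewrite invr_ge0.
exists (1 + \sum_i `|f i|^-1)^-1; first by rewrite invr_gt0; lra.
move=> i fi; rewrite -[`|f i|]invrK lef_pV2 ?posrE ?invr_gt0 ?normr_gt0 //; last lra.
rewrite (bigD1 i) //= addrCA lerDl addr_ge0 // sumr_ge0 // => j _.
Qed.

(** Dividing k and l by their greatest common divisor only decreases the linear
    form.  A coprime pair with large l is covered by [coprime_linear_form_ge]; when
    l is bounded and the form is less than 1, there are finitely many pairs. *)
Lemma linear_form_ge (R : realType) (b c : nat) (rho : R) :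
  (1 < b)%N -> (1 < c)%N -> 1 < rho ->
  exists2 C : R, 0 < C & forall k l, (b ^ k != c ^ l)%N ->
    C * (rho ^+ (k + l))^-1 <= `|k%:R * ln (b%:R : R) - l%:R * ln c%:R|.
Proof.
move=> b1 c1 rho1.
pose Lam (k l : nat) : R := k%:R * ln (b%:R : R) - l%:R * ln c%:R.
have lnb := ln_nat_ge_half R b1.
have lnc : ln (c%:R : R) <= c%:R.
  have := @ln_le_sub1 R c%:R; rewrite ltr0n (ltnW c1) => /(_ isT); lra.
have lnc0 : 0 <= ln (c%:R : R) by have := ln_nat_ge_half R c1; lra.
have small k l : `|Lam k l| < 1 -> (k <= 2 * (l * c + 1))%N.
  rewrite /Lam ltr_norml => /andP[_ h]; rewrite -(ler_nat R) natrM natrD natrM.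
  have : k%:R * (1 / 2) <= k%:R * ln (b%:R : R) by rewrite ler_wpM2l.
  have : l%:R * ln (c%:R : R) <= l%:R * c%:R by rewrite ler_wpM2l.
  by lra.
have [l0 hl0] := @coprime_linear_form_ge R b c (2 * (c + 1)) rho b1 c1 rho1.
have [C1 C10 hC1] := @finite_gap R ('I_(2 * (l0.+1 * c + 1)).+1 * 'I_l0.+1)%type
  (fun kl => Lam kl.1 kl.2).
exists (Num.min 1 C1); first by rewrite lt_min ltr01.
move=> k l ne; rewrite -/(Lam k l).
have rp n : 1 <= rho ^+ n by rewrite exprn_ege1 // ltW.
have rn n : 0 < (rho ^+ n)^-1 <= 1.
  by rewrite invr_gt0 invf_le1 ?rp ?(lt_le_trans ltr01) ?rp.
have g0 : (0 < gcdn k l)%N.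
  rewrite gcdn_gt0 !lt0n; case: (k =P 0%N) => //= k0; case: (l =P 0%N) => //= l0'.
  by move: ne; rewrite k0 l0'.
pose k' := (k %/ gcdn k l)%N; pose l' := (l %/ gcdn k l)%N.
have kE : k = (gcdn k l * k')%N by rewrite mulnC divnK // dvdn_gcdl.
have lE : l = (gcdn k l * l')%N by rewrite mulnC divnK // dvdn_gcdr.
have kl' : coprime k' l'.
  rewrite /coprime -(eqn_pmul2l g0) muln_gcdr -kE -lE muln1.
  by [].
have LE : Lam k l = (gcdn k l)%:R * Lam k' l'.
  have -> : Lam k l = (gcdn k l * k')%:R * ln b%:R - (gcdn k l * l')%:R * ln c%:R.
    by rewrite -kE -lE.
  by rewrite /Lam !natrM; ring.
have L0 : Lam k l != 0.
  apply: contraNneq ne => /eqP; rewrite /Lam subr_eq0 => /eqP h.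
  have := congr1 expR h; rewrite !expRM_natl !lnK ?posrE ?ltr0n ?(ltnW b1) ?(ltnW c1) //.
  by rewrite -!natrX => /eqP; rewrite eqr_nat.
have L'0 : Lam k' l' != 0 by apply: contraNneq L0 => h; rewrite LE h mulr0.
apply: (@le_trans _ _ `|Lam k' l'|); last first.
  by rewrite LE normrM normr_nat ler_peMl // ler1n.
have /andP[r0 r1] := rn (k + l)%N.
have m1 : Num.min 1 C1 <= 1 by rewrite ge_min lexx.
have m2 : Num.min 1 C1 <= C1 by rewrite ge_min lexx orbT.
have m0 : 0 < Num.min 1 C1 by rewrite lt_min ltr01.
have [big|sm] := leP 1 `|Lam k' l'|.
  by apply: le_trans big; rewrite mulr_ile1 // ltW.
have [ll|ll] := ltnP l' l0.+1.
  have kk : (k' < (2 * (l0.+1 * c + 1)).+1)%N.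
    rewrite ltnS (leq_trans (small _ _ sm)) // leq_mul // leq_add // leq_mul //.
    exact: ltnW.
  apply: (@le_trans _ _ C1); last exact: (hC1 (Ordinal kk, Ordinal ll)).
  by apply: le_trans m2; rewrite ler_piMr // ltW.
apply: (@le_trans _ _ (rho ^+ l')^-1).
  apply: (@le_trans _ _ (rho ^+ (k + l))^-1); first by rewrite ler_piMl // ltW.
  rewrite lef_pV2 ?posrE ?(lt_le_trans ltr01) ?rp // ler_weXn2l ?ltW //.
  by rewrite (leq_trans (leq_div _ _)) // leq_addl.
apply/ltW/hl0 => //; first exact: ltnW.
apply: leq_trans (small _ _ sm) _.
by rewrite -mulnA leq_mul // mulnDl mul1n [(l' * c)%N]mulnC leq_add // (leq_trans _ ll).
Qed.

(** If |b ^ k - c ^ l| < c ^ l / 2, then ln is Lipschitz with constant 2 / c ^ l on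
    the interval between the two powers, so the lower bound for the difference of
    the logarithms yields one for the difference of the powers. *)
Lemma power_gap (R : realType) (b c : nat) (rho : R) :
  (1 < b)%N -> (1 < c)%N -> 1 < rho ->
  exists2 C : R, 0 <= C & forall k l, (b ^ k != c ^ l)%N ->
    (c ^ l)%:R <= C * rho ^+ (k + l) * `|(b ^ k)%:R - (c ^ l)%:R|.
Proof.
move=> b1 c1 rho1; have [C0 C00 hC0] := linear_form_ge b1 c1 rho1.
exists (2 + 2 / C0); first by rewrite addr_ge0 // divr_ge0 // ltW.
move=> k l ne; have := hC0 k l ne.
have b0 : 0 < b%:R :> R by rewrite ltr0n ltnW.
have c0 : 0 < c%:R :> R by rewrite ltr0n ltnW.
rewrite !natrX [k%:R * _]mulr_natl [l%:R * _]mulr_natl -!lnXn //.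
set x := b%:R ^+ k; set y := c%:R ^+ l.
have x0 : 0 < x by exact: exprn_gt0.
have y0 : 0 < y by exact: exprn_gt0.
have r1 : 1 <= rho ^+ (k + l) by rewrite exprn_ege1 // ltW.
set r := rho ^+ (k + l) in r1 *; move=> hL.
have xy0 : 0 <= `|x - y| by [].
have C2 : 0 <= 2 / C0 by rewrite divr_ge0 // ltW.
have i0 : 0 <= 2 / C0 * r * `|x - y| by rewrite !mulr_ge0 //; lra.
have -> : (2 + 2 / C0) * r * `|x - y| = 2 * (r * `|x - y|) + 2 / C0 * r * `|x - y|.
  by ring.
have i1 : 2 * `|x - y| <= 2 * (r * `|x - y|) by rewrite ler_pM2l // ler_peMl.
have i2 : 0 <= 2 * (r * `|x - y|) by rewrite !mulr_ge0 //; lra.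
have [far|near_] := leP (y / 2) `|x - y|; first by lra.
have xy : y / 2 <= x by move: near_; rewrite ltr_norml => /andP[]; lra.
suff h : `|ln x - ln y| <= 2 * `|x - y| / y.
  have := le_trans hL h; rewrite ler_pdivlMr // mulrAC ler_pdivrMr; last by lra.
  rewrite -[C0 * y]mulrC -ler_pdivlMr //.
  have -> : 2 * `|x - y| * r / C0 = 2 / C0 * r * `|x - y| by ring.
  lra.
have lnB (u v : R) : 0 < u -> 0 < v -> ln u - ln v <= (u - v) / v.
  move=> u0 v0; rewrite -ln_div ?posrE //.
  apply: le_trans (ln_le_sub1 (divr_gt0 u0 v0)) _.
  by rewrite mulrBl divff // gt_eqF.
rewrite ler_norml; apply/andP; split.
  rewrite lerNl opprB; apply: le_trans (lnB _ _ y0 x0) _.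
  apply: (@le_trans _ _ (`|x - y| / x)).
    by rewrite ler_pM2r ?invr_gt0 // distrC ler_norm.
  rewrite ler_pdivrMr // (_ : _ * x = `|x - y| * (2 * x / y)); last by ring.
  by rewrite ler_peMr // ler_pdivlMr //; lra.
apply: le_trans (lnB _ _ x0 y0) _; rewrite ler_pM2r ?invr_gt0 //.
by apply: le_trans (ler_norm _) _; lra.
Qed.

(** * Integrals of cosines against cosines *)

Lemma is_derive_continuous (R : realType) (f df : R -> R) :
  (forall x : R, is_derive x 1 f (df x)) -> continuous f.
Proof.
move=> fdf x; apply: differentiable_continuous; apply/derivable1_diffP.
exact: ex_derive.
Qed.

Lemma mean_value (R : realType) (f df : R -> R) (a b : R) :
  (forall x : R, is_derive x 1 f (df x)) -> a <= b ->
  exists2 c, a <= c <= b & f b - f a = df c * (b - a).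
Proof.
move=> fdf ab; have [|c] := MVT_segment ab (fun x _ => fdf x).
  apply: continuous_subspaceT => x; exact: is_derive_continuous fdf x.
by rewrite in_itv /=; exists c.
Qed.

Lemma norm_cos_le1 (R : realType) (x : R) : `|cos x| <= 1.
Proof. by rewrite ler_norml cos_geN1 cos_le1. Qed.

Lemma norm_sin_le1 (R : realType) (x : R) : `|sin x| <= 1.
Proof. by rewrite ler_norml sin_geN1 sin_le1. Qed.

Lemma cos_lipschitz (R : realType) (x y : R) : `|cos x - cos y| <= `|x - y|.
Proof.
wlog yx : x y / y <= x.
  move=> h; case/orP: (le_total x y) => [/h|/h //].
  by rewrite distrC [leRHS]distrC.
have [c _ ->] := mean_value (@is_derive_cos R) yx.
by rewrite normrM normrN ler_piMl // norm_sin_le1.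
Qed.

(** The left-hand side is at most 2 and at most 4 x, with x = |p| |t - s|; both
    are at most 8 x ^ th, according to whether x is greater or less than 1. *)
Lemma cos_osc (R : realType) (p s t th : R) : 0 <= th <= 1 ->
  `|cos (p * pi * t) - cos (p * pi * s)| <= 8 * (`|p| `^ th * `|t - s| `^ th).
Proof.
move=> /andP[th0 th1]; set d := `|_ - _|; set x := `|p| * `|t - s|.
have x0 : 0 <= x by rewrite mulr_ge0.
rewrite -powRM // -/x.
have d2 : d <= 2.
  apply: le_trans (ler_normB _ _) _.
  by have := norm_cos_le1 (p * pi * t); have := norm_cos_le1 (p * pi * s); lra.
have dx : d <= 4 * x.
  apply: le_trans (cos_lipschitz _ _) _.
  rewrite -mulrBr !normrM -mulrA mulrCA /x ler_wpM2r // ger0_norm ?pi_ge0 //.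
  by have := @pihalf_lt2 R; lra.
have [x1|x1] := leP 1 x.
  have : 1 <= x `^ th by rewrite -(powRr0 x) ler_powR.
  lra.
have [x00|x00] := eqVneq x 0.
  by move: dx; rewrite x00 mulr0 => /le_trans; apply; rewrite mulr_ge0 // powR_ge0.
have : x <= x `^ th by apply: ger1_powR => //; rewrite lt_neqAle eq_sym x00 x0 ltW.
lra.
Qed.

(** This turns a divisor D that may be smaller than q into the constant G, at no
    cost in the power of q. *)
Lemma ratio_powR_le (R : realType) (q D G th : R) : 0 < q -> 0 < D -> 1 <= G ->
  q <= G * D -> 0 <= th <= 1 -> q * (D `^ th / D) <= G * q `^ th.
Proof.
move=> q0 D0 G1 qGD /andP[th0 th1].
have qth : 0 <= q `^ th by exact: powR_ge0.
rewrite mulrA ler_pdivrMr //.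
have [qD|Dq] := leP q D.
  apply: (@le_trans _ _ (q `^ th * D)); last first.
    by rewrite ler_pM2r // ler_peMl.
  have Dq1 : 1 <= D / q by rewrite ler_pdivlMr // mul1r.
  have -> : D `^ th = q `^ th * (D / q) `^ th.
    rewrite -powRM ?(ltW q0) ?(le_trans ler01 Dq1) //.
    by rewrite mulrCA divff ?mulr1 // gt_eqF.
  by rewrite mulrCA ler_wpM2l // mulrC -ler_pdivlMr // ler1_powR.
have : D `^ th <= q `^ th.
  by apply: ge0_ler_powR => //; rewrite ?nnegrE; exact: ltW.
have : 0 <= D `^ th by exact: powR_ge0.
move=> h1 h2; rewrite mulrAC; apply: ler_pM => //; exact: ltW.
Qed.

(** A primitive of cos (p pi r) d cos (q pi r).  For p = q the second quotient is
    0, as the inverse of 0 is 0, which is the right value. *)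
Definition cos_dcos_primitive (R : realType) (p q r : R) : R :=
  q / 2 * (cos ((p + q) * pi * r) / (p + q) - cos ((p - q) * pi * r) / (p - q)).

(** The integral over [s, t] of cos (p pi r) - cos (p pi s) against
    d cos (q pi r). *)
Definition cos_area (R : realType) (p q s t : R) : R :=
  cos_dcos_primitive p q t - cos_dcos_primitive p q s
  - cos (p * pi * s) * (cos (q * pi * t) - cos (q * pi * s)).

Lemma cos_area_by_parts (R : realType) (p q s t : R) : p != q -> p + q != 0 ->
  cos_area p q s t + cos_area q p s t =
  (cos (p * pi * t) - cos (p * pi * s)) * (cos (q * pi * t) - cos (q * pi * s)).
Proof.
move=> pq pq0.
have prod r : cos_dcos_primitive p q r + cos_dcos_primitive q p r =
    cos (p * pi * r) * cos (q * pi * r).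
  rewrite /cos_dcos_primitive -(opprB p q) !mulNr cosN (addrC q p).
  rewrite (_ : (p + q) * pi * r = p * pi * r + q * pi * r); last by ring.
  rewrite (_ : (p - q) * pi * r = p * pi * r - q * pi * r); last by ring.
  rewrite cosD cosB.
  have pq1 : p - q != 0 by rewrite subr_eq0.
  by field; rewrite pq1 pq0.
rewrite /cos_area; have := prod t; have := prod s; lra.
Qed.

(** For q <= p all three terms of the integral are controlled by
    q ^ (2 gam) |t - s| ^ (2 gam), which is at most the claimed bound.  For p < q the
    boundary term cos (p pi s) (cos (q pi t) - cos (q pi s)) alone is too large; an
    integration by parts puts the lower frequency under the differential again. *)
Lemma cos_area_le (R : realType) (p q s t G gam : R) : 0 < p -> 0 < q -> 1 <= G ->
  (p != q -> p <= G * `|p - q| /\ q <= G * `|p - q|) -> 0 <= gam <= 1 / 2 ->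
  `|cos_area p q s t| <= 80 * G * (p `^ gam * q `^ gam) * `|t - s| `^ (2 * gam).
Proof.
move=> p0 q0 G1 gap /andP[g0 g2].
have th01 : 0 <= 2 * gam <= 1 by lra.
have main (x y : R) : 0 < x -> 0 < y -> y <= x ->
    (x != y -> y <= G * `|x - y|) ->
    `|cos_area x y s t| <= 16 * G * (x `^ gam * y `^ gam) * `|t - s| `^ (2 * gam).
  move=> x0 y0 yx gapxy.
  set T := `|t - s| `^ (2 * gam).
  have T0 : 0 <= T by exact: powR_ge0.
  set Y := y `^ (2 * gam).
  have Y0 : 0 <= Y by exact: powR_ge0.
  have piece (D : R) : y <= G * `|D| \/ D = 0 ->
     `|y / 2 * (cos (D * pi * t) / D - cos (D * pi * s) / D)| <= 4 * G * Y * T.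
    move=> [yGD|->]; last first.
      by rewrite invr0 !mulr0 subrr mulr0 normr0 !mulr_ge0 //; lra.
    have D0 : 0 < `|D| by rewrite -(pmulr_rgt0 _ (lt_le_trans ltr01 G1)); lra.
    rewrite -mulrBl !normrM !normfV (gtr0_norm y0) normr_nat.
    have := @cos_osc _ D s t _ th01; rewrite -/T => osc.
    have rat := @ratio_powR_le _ y `|D| G (2 * gam) y0 D0 G1 yGD th01.
    apply: (@le_trans _ _ (y / 2 * (8 * (`|D| `^ (2 * gam) * T) / `|D|))).
      by rewrite ler_wpM2l ?divr_ge0 ?(ltW y0) // ler_pM2r ?invr_gt0.
    have -> : y / 2 * (8 * (`|D| `^ (2 * gam) * T) / `|D|) =
      4 * (y * (`|D| `^ (2 * gam) / `|D|)) * T by lra.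
    by rewrite ler_wpM2r // -mulrA ler_wpM2l.
  have yG : y <= G * y by rewrite ler_peMl // ltW.
  have c1 : y <= G * `|x + y|.
    rewrite gtr0_norm ?addr_gt0 // (le_trans yG) // ler_wpM2l ?lerDr ?(ltW x0) //.
    lra.
  have c2 : y <= G * `|x - y| \/ x - y = 0.
    have [->|xy] := eqVneq x y; first by right; rewrite subrr.
    by left; exact: gapxy.
  have h1 := piece _ (or_introl c1); have h2 := piece _ c2.
  have h3 : `|cos (x * pi * s) * (cos (y * pi * t) - cos (y * pi * s))| <= 8 * G * Y * T.
    rewrite normrM; apply: (@le_trans _ _ (1 * (8 * (Y * T)))).
      apply: ler_pM => //; first exact: norm_cos_le1.
      by have := @cos_osc _ y s t _ th01; rewrite (gtr0_norm y0).
    rewrite mul1r; have : 0 <= (G - 1) * (Y * T) by rewrite !mulr_ge0 // subr_ge0.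
    lra.
  have YX : Y <= x `^ gam * y `^ gam.
    rewrite /Y mulrC powRrM powR_mulrn ?powR_ge0 // expr2.
    rewrite ler_wpM2r ?powR_ge0 //.
    by apply: ge0_ler_powR => //; rewrite ?nnegrE ltW.
  apply: (@le_trans _ _ (16 * G * Y * T)); last first.
    by rewrite ler_wpM2r // ler_wpM2l //; lra.
  have -> : cos_area x y s t =
    y / 2 * (cos ((x + y) * pi * t) / (x + y) - cos ((x + y) * pi * s) / (x + y))
    - y / 2 * (cos ((x - y) * pi * t) / (x - y) - cos ((x - y) * pi * s) / (x - y))
    - cos (x * pi * s) * (cos (y * pi * t) - cos (y * pi * s)).
    by rewrite /cos_area /cos_dcos_primitive; ring.
  apply: le_trans (ler_normB _ _) _.
  have := lerD (le_trans (ler_normB _ _) (lerD h1 h2)) h3.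
  lra.
have pos x y : 0 <= G * (x `^ gam * y `^ gam) * `|t - s| `^ (2 * gam).
  by rewrite !mulr_ge0 ?powR_ge0 //; lra.
have [qp|pq] := leP q p.
  have := main p q p0 q0 qp (fun ne => (gap ne).2); have := pos p q; lra.
have pqne : p != q by rewrite lt_eqF.
have := main q p q0 p0 (ltW pq) _; rewrite eq_sym distrC => /(_ (fun ne => (gap ne).1)).
have := @cos_area_by_parts _ p q s t pqne; rewrite gt_eqF ?addr_gt0 // => /(_ isT) parts.
have -> : cos_area p q s t =
  (cos (p * pi * t) - cos (p * pi * s)) * (cos (q * pi * t) - cos (q * pi * s))
  - cos_area q p s t by rewrite -parts addrK.
move=> Eqp; apply: le_trans (ler_normB _ _) _.
have prod : `|(cos (p * pi * t) - cos (p * pi * s)) * (cos (q * pi * t) - cos (q * pi * s))|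
    <= 64 * (p `^ gam * q `^ gam * `|t - s| `^ (2 * gam)).
  rewrite normrM [2 * gam]mulrC powRrM powR_mulrn ?powR_ge0 //.
  have g01 : 0 <= gam <= 1 by lra.
  apply: le_trans (ler_pM _ _ (@cos_osc _ p s t _ g01) (@cos_osc _ q s t _ g01)) _ => //.
  by rewrite (gtr0_norm p0) (gtr0_norm q0) le_eqVlt; apply/orP; left; apply/eqP; ring.
have : 0 <= (G - 1) * (p `^ gam * q `^ gam * `|t - s| `^ (2 * gam)).
  by rewrite !mulr_ge0 ?powR_ge0 // subr_ge0.
move: Eqp prod; rewrite [q `^ gam * _]mulrC.
lra.
Qed.

(** * Geometric convergence of the iterated integrals *)

Lemma geometric_cauchy (R : realType) (u : nat -> R) (B z : R) :
  0 <= z < 1 -> (forall n, `|u n.+1 - u n| <= B * z ^+ n) ->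
  cvgn u /\ forall n, `|limn u - u n| <= B * z ^+ n / (1 - z).
Proof.
move=> /andP[z0 z1] uB.
have tail n m : `|u (n + m)%N - u n| <= B * z ^+ n / (1 - z) * (1 - z ^+ m).
  elim: m => [|m IH]; first by rewrite addn0 !subrr normr0 mulr0.
  rewrite addnS -(subrKA (u (n + m)%N)); apply: le_trans (ler_normD _ _) _.
  apply: le_trans (lerD (uB _) IH) _; rewrite exprD exprS le_eqVlt.
  by apply/orP; left; apply/eqP; field; rewrite subr_eq0 gt_eqF.
have B0 : 0 <= B by have := le_trans (normr_ge0 _) (uB 0%N); rewrite mulr1.
have tail' n m : `|u (n + m)%N - u n| <= B * z ^+ n / (1 - z).
  apply: le_trans (tail n m) _; rewrite ler_piMr ?divr_ge0 ?mulr_ge0 ?exprn_ge0 //.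
    lra.
  by rewrite gerBl exprn_ge0.
have cu : cvgn u.
  have -> : u = fun n => u 0%N + series (telescope u) n.
    by apply/funext => n; rewrite telescopeK /= addrC subrK.
  apply: is_cvgD; first exact: is_cvg_cst.
  apply: normed_cvg; apply: (@series_le_cvg _ _ (geometric B z)).
  - by move=> n; exact: normr_ge0.
  - by move=> n; rewrite /geometric /= mulr_ge0 // exprn_ge0.
  - exact: uB.
  - by apply: is_cvg_geometric_series; rewrite ger0_norm.
split=> // n.
have : `|u (k + n)%N - u n| @[k --> \oo] --> `|limn u - u n|.
  apply: cvg_norm; apply: cvgB; last exact: cvg_cst.
  by have := cu; rewrite -[X in X -> _](cvg_shiftn n).
move=> /cvgr_to_le; apply; apply: nearW => k /=; by rewrite addnC.
Qed.

Lemma powR_exprn (R : realType) (x gam : R) (n : nat) : 0 <= x ->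
  (x ^+ n) `^ gam = (x `^ gam) ^+ n.
Proof.
move=> x0; have -> : x ^+ n = x `^ n%:R by rewrite powR_mulrn.
by rewrite powRAC powR_mulrn // powR_ge0.
Qed.

Definition area_partial (R : realType) (a : R) (b : nat) (a' : R) (b' : nat)
    (N : nat) (s t : R) : R :=
  \sum_(k < N.+1) \sum_(l < N.+1)
    a ^+ k * a' ^+ l * cos_area (b%:R ^+ k) (b'%:R ^+ l) s t.

(** The loss rho ^ (k + l) from the small divisors is absorbed by the geometric
    decay, as rho is taken so close to 1 that rho a b ^ gam and rho a' b' ^ gam are
    still less than 1. *)
Lemma area_term_le (R : realType) (a a' gam : R) (b b' : nat) :
  0 < a -> 0 < a' -> (1 < b)%N -> (1 < b')%N -> 0 <= gam <= 1 / 2 ->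
  a * b%:R `^ gam < 1 -> a' * b'%:R `^ gam < 1 ->
  exists C z : R, [/\ 0 <= C, 0 <= z < 1 & forall k l s t,
    `|a ^+ k * a' ^+ l * cos_area (b%:R ^+ k) (b'%:R ^+ l) s t|
    <= C * z ^+ (k + l) * `|t - s| `^ (2 * gam)].
Proof.
move=> a0 a'0 b1 b'1 g ab a'b'.
have b0 : 0 < b%:R :> R by rewrite ltr0n ltnW.
have b'0 : 0 < b'%:R :> R by rewrite ltr0n ltnW.
set y := a * _ in ab; set y' := a' * _ in a'b'.
have y0 : 0 < y by rewrite mulr_gt0 ?powR_gt0.
have y'0 : 0 < y' by rewrite mulr_gt0 ?powR_gt0.
pose x := Num.max y y'.
have x0 : 0 < x by rewrite lt_max y0.
have x1 : x < 1 by rewrite gt_max ab.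
pose z := (1 + x) / 2; pose rho := z / x.
have rho1 : 1 < rho by rewrite ltr_pdivlMr // mul1r /z; lra.
have [C1 C10 gap1] := power_gap b1 b'1 rho1.
have [C2 C20 gap2] := power_gap b'1 b1 rho1.
exists (80 * (1 + C1 + C2)), z; split; first lra.
  by rewrite /z; apply/andP; split; lra.
move=> k l s t; rewrite !normrM.
have r1 : 1 <= rho ^+ (k + l) by rewrite exprn_ege1 // ltW.
pose G := (1 + C1 + C2) * rho ^+ (k + l).
have Ege : 0 <= (1 + C1 + C2) * (rho ^+ (k + l) - 1).
  by rewrite mulr_ge0 ?subr_ge0 //; lra.
have G1 : 1 <= G by rewrite /G; lra.
have := @cos_area_le R (b%:R ^+ k) (b'%:R ^+ l) s t G gam.
rewrite !exprn_gt0 // => /(_ isT isT G1 _ g) h.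
have {}h := h _; rewrite (gtr0_norm (exprn_gt0 _ a0)) (gtr0_norm (exprn_gt0 _ a'0)).
apply: (@le_trans _ _ (a ^+ k * a' ^+ l * (80 * G * ((b%:R ^+ k) `^ gam * (b'%:R ^+ l) `^ gam)
      * `|t - s| `^ (2 * gam)))).
  rewrite ler_wpM2l ?mulr_ge0 ?exprn_ge0 ?(ltW a0) ?(ltW a'0) //; apply: h => ne.
  have nk : (b ^ k != b' ^ l)%N by rewrite -(eqr_nat R) !natrX.
  have := gap1 _ _ nk; have := gap2 l k; rewrite eq_sym nk => /(_ isT).
  rewrite [`|_ - (b ^ k)%:R|]distrC [(l + k)%N]addnC !natrX.
  set D := `|_ - _|; set r := rho ^+ (k + l) in r1 *.
  have D00 : 0 <= D by exact: normr_ge0.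
  have r0 : 0 <= r by lra.
  have D0 : 0 <= r * D by rewrite mulr_ge0.
  have d1 : 0 <= C1 * (r * D) by rewrite mulr_ge0.
  have d2 : 0 <= C2 * (r * D) by rewrite mulr_ge0.
  by rewrite /G -/r; split; lra.
rewrite !powR_exprn ?(ltW b0) ?(ltW b'0) // mulrA ler_wpM2r ?powR_ge0 //.
have -> : a ^+ k * a' ^+ l * (80 * G * (b%:R `^ gam ^+ k * b'%:R `^ gam ^+ l)) =
   80 * (1 + C1 + C2) * (rho ^+ (k + l) * (y ^+ k * y' ^+ l)).
  by rewrite /G /y /y' !exprMn; ring.
rewrite ler_wpM2l //; first lra.
have -> : z = rho * x by rewrite /rho mulrAC -mulrA divff ?mulr1 // gt_eqF.
rewrite [leRHS]exprMn ler_wpM2l //; first lra.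
rewrite exprD ler_pM ?exprn_ge0 ?(ltW y0) ?(ltW y'0) //.
  by rewrite lerXn2r ?nnegrE ?(ltW y0) ?(ltW x0) // le_max lexx.
by rewrite lerXn2r ?nnegrE ?(ltW y'0) ?(ltW x0) // le_max lexx orbT.
Qed.

(** The terms added at step N + 1 have k = N + 1 or l = N + 1. *)
Lemma area_partial_step (R : realType) (a a' gam : R) (b b' : nat) :
  0 < a -> 0 < a' -> (1 < b)%N -> (1 < b')%N -> 0 <= gam <= 1 / 2 ->
  a * b%:R `^ gam < 1 -> a' * b'%:R `^ gam < 1 ->
  exists C z : R, [/\ 0 <= C, 0 <= z < 1,
    forall s t, `|area_partial a b a' b' 0 s t| <= C * `|t - s| `^ (2 * gam) &
    forall N s t, `|area_partial a b a' b' N.+1 s t - area_partial a b a' b' N s t|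
      <= C * `|t - s| `^ (2 * gam) * z ^+ N].
Proof.
move=> a0 a'0 b1 b'1 g ab a'b'.
have [C [z [C0 z01 hC]]] := area_term_le a0 a'0 b1 b'1 g ab a'b'.
have /andP[z0 z1] := z01.
exists (2 * C / (1 - z)), z; split => //.
- by rewrite divr_ge0 ?mulr_ge0 // subr_ge0 ltW.
- move=> s t; rewrite /area_partial !big_ord1; apply: le_trans (hC _ _ _ _) _.
  rewrite mulr1 ler_wpM2r ?powR_ge0 // ler_pdivlMr ?subr_gt0 //.
  have : 0 <= C * z by rewrite mulr_ge0.
  lra.
move=> N s t; set T := _ `^ _.
have T0 : 0 <= T by exact: powR_ge0.
pose u k l := a ^+ k * a' ^+ l * cos_area (b%:R ^+ k) (b'%:R ^+ l) s t.
have -> : area_partial a b a' b' N.+1 s t - area_partial a b a' b' N s t =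
    \sum_(k < N.+1) u k N.+1 + \sum_(l < N.+2) u N.+1 l.
  rewrite /area_partial big_ord_recr /=.
  under eq_bigr => k _ do rewrite big_ord_recr /=.
  rewrite big_split /= /u; ring.
have bound n (v : nat -> R) : (forall k, `|v k| <= C * T * z ^+ N * z ^+ k) ->
    `|\sum_(k < n) v k| <= C / (1 - z) * T * z ^+ N.
  move=> hv; apply: le_trans (ler_norm_sum _ _ _) _.
  apply: (@le_trans _ _ (\sum_(k < n) C * T * z ^+ N * z ^+ k)).
    by apply: ler_sum => k _; exact: hv.
  rewrite -mulr_sumr -[leRHS](_ : C * T * z ^+ N * (1 - z)^-1 = _); last by ring.
  rewrite ler_wpM2l ?mulr_ge0 ?exprn_ge0 //.
  have := subrX1 z n; rewrite -(opprB 1 (z ^+ n)) -(opprB 1 z) mulNr => /oppr_inj e.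
  rewrite -[leLHS](mulKf (x := 1 - z)) ?gt_eqF ?subr_gt0 // -e.
  by rewrite ler_piMr ?invr_ge0 ?subr_ge0 ?(ltW z1) // gerBl exprn_ge0.
apply: le_trans (ler_normD _ _) _.
have term k l : (N < k + l)%N -> `|u k l| <= C * T * z ^+ (k + l).-1.
  move=> kl; apply: le_trans (hC k l s t) _; rewrite -/T mulrAC ler_wpM2l ?mulr_ge0 //.
  by rewrite ler_wiXn2l ?leq_pred // ltW.
have h1 := @bound N.+1 (fun k => u k N.+1) _.
have h2 := @bound N.+2 (fun l => u N.+1 l) _.
have -> : 2 * C / (1 - z) * T * z ^+ N = C / (1 - z) * T * z ^+ N + C / (1 - z) * T * z ^+ N.
  by ring.
apply: lerD; [apply: h1 => k | apply: h2 => l].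
  by rewrite -mulrA -exprD (le_trans (term _ _ _)) ?addnS ?ltnS ?leq_addl //= addnC.
by rewrite -mulrA -exprD (le_trans (term _ _ _)) ?addSn ?ltnS ?leq_addr.
Qed.

(** * Riemann-Stieltjes integrals with a primitive *)

Lemma itv_partition_mesh (R : realType) (s t delta : R) :
  s <= t -> 0 < delta -> exists2 p, itv_partition s t p & mesh_lt s p delta.
Proof.
move=> st d0; have [n] : exists n : nat, t - s <= n%:R * (delta / 2).
  exists (Num.truncn ((t - s) / (delta / 2))).+1.
  by rewrite -ler_pdivrMr ?divr_gt0 // ltW // truncnS_gt.
elim: n s st => [|n IH] s st; rewrite ?mul0r => h.
  by exists [::]; rewrite /itv_partition //= eq_le st /=; split => //; lra.
have [->|st'] := eqVneq s t; first by exists [::]; rewrite /itv_partition //= eqxx.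
have [small|big] := ltP (t - s) delta.
  exists [:: t]; first by rewrite /itv_partition /= andbT eqxx lt_neqAle st' st.
  by case.
have [||p [pp pl] pm] := IH (s + delta / 2).
- lra.
- by move: h; rewrite -natr1; lra.
exists (s + delta / 2 :: p).
  by split => //=; rewrite pp andbT ltrDl divr_gt0.
case=> [_|k kp] /=; last exact: pm.
by rewrite /part_pt /=; lra.
Qed.

Lemma is_RS_integral_unique (R : realType) (f g : R -> R) (s t l l' : R) :
  s <= t -> is_RS_integral f g s t l -> is_RS_integral f g s t l' -> l = l'.
Proof.
move=> st hl hl'; apply/eqP; rewrite -subr_eq0 -normr_eq0; apply/negPn/negP => ne.
have e0 : 0 < `|l - l'| / 2 by rewrite divr_gt0 // lt_neqAle eq_sym ne normr_ge0.
have [d d0 hd] := hl _ e0; have [d' d'0 hd'] := hl' _ e0.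
have [||p pp pm] := @itv_partition_mesh _ s t (Num.min d d'); first by [].
  by rewrite lt_min d0.
have tag : is_tagging s p (part_pt s p).
  move=> k kp; rewrite lexx /=; case: pp => /pathP path _; exact/ltW/(path 0).
have h1 : mesh_lt s p d by move=> k /pm; rewrite lt_min => /andP[].
have h2 : mesh_lt s p d' by move=> k /pm; rewrite lt_min => /andP[].
have := ltrD (hd _ _ pp tag h1) (hd' _ _ pp tag h2).
rewrite -splitr ltNge; apply/negP; rewrite negbK.
set S := RS_sum _ _ _ _ _; rewrite -(opprB l S) normrN.
have -> : l - l' = (l - S) + (S - l') by ring.
exact: ler_normD.
Qed.

(** On an interval of the subdivision with tag xi, the mean value theorem for
    H - f (xi) g bounds the error of the Riemann-Stieltjes sum by Lf M times the
    mesh times the length of the interval. *)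
Lemma is_RS_integral_primitive (R : realType) (f g dg H : R -> R) (s t Lf M : R) :
  (forall x : R, is_derive x 1 g (dg x)) ->
  (forall x : R, is_derive x 1 H (f x * dg x)) ->
  (forall x y, `|f x - f y| <= Lf * `|x - y|) -> (forall x, `|dg x| <= M) ->
  s <= t -> is_RS_integral f g s t (H t - H s).
Proof.
move=> gd Hd fL dgM st eps e0.
have M0 : 0 <= M by apply: le_trans (dgM 0); exact: normr_ge0.
have L0 : 0 <= Lf.
  by have := le_trans (normr_ge0 _) (fL 1 0); rewrite subr0 normr1 mulr1.
pose K := Lf * M * (t - s).
have K0 : 0 <= K by rewrite !mulr_ge0 // subr_ge0.
exists (eps / (K + 1)); first by rewrite divr_gt0 //; lra.
move=> p xi [pp pl] tag pm; set delta := eps / (K + 1) in pm *.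
have d0 : 0 < delta by rewrite divr_gt0 //; lra.
have tele (F : R -> R) : F t - F s =
    \sum_(k < size p) (F (part_pt s p k.+1) - F (part_pt s p k)).
  rewrite -(big_mkord xpredT (fun k => F (part_pt s p k.+1) - F (part_pt s p k))).
  rewrite telescope_sumr // /part_pt /= -(eqP pl) (last_nth 0).
  by [].
rewrite /RS_sum (tele H) -sumrB.
have step (k : 'I_(size p)) :
  `|f (xi k) * (g (part_pt s p k.+1) - g (part_pt s p k)) -
    (H (part_pt s p k.+1) - H (part_pt s p k))| <=
   Lf * M * delta * (part_pt s p k.+1 - part_pt s p k).
  have := tag k (ltn_ord k); have := pm k (ltn_ord k).
  set u := part_pt s p k; set v := part_pt s p k.+1.
  move=> vu /andP[ux xv]; have uv : u <= v by exact: le_trans xv.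
  pose phi x := H x - f (xi k) * g x.
  have phid (x : R) : is_derive x 1 phi (f x * dg x - f (xi k) * dg x).
    apply: is_deriveB; apply: is_deriveZ.
  have [c /andP[uc cv] e] := mean_value phid uv.
  have -> : f (xi k) * (g v - g u) - (H v - H u) = - (phi v - phi u).
    by rewrite /phi; ring.
  rewrite e normrN -mulrBl !normrM (@ger0_norm _ (v - u)) ?subr_ge0 //.
  rewrite ler_wpM2r ?subr_ge0 // [leRHS]mulrAC ler_pM //.
  apply: le_trans (fL _ _) _; rewrite ler_wpM2l //.
  by apply/ltW; apply: le_lt_trans vu; rewrite ler_norml; apply/andP; split; lra.
apply: le_lt_trans (ler_norm_sum _ _ _) _.
apply: le_lt_trans (ler_sum _ (fun k _ => step k)) _.
rewrite -mulr_sumr -(tele id).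
have -> : Lf * M * delta * (id t - id s) = K * eps / (K + 1).
  by rewrite /K /delta /=; ring.
by rewrite ltr_pdivrMr; lra.
Qed.

Lemma RS_integral_primitive (R : realType) (f g dg H : R -> R) (s t Lf M : R) :
  (forall x : R, is_derive x 1 g (dg x)) ->
  (forall x : R, is_derive x 1 H (f x * dg x)) ->
  (forall x y, `|f x - f y| <= Lf * `|x - y|) -> (forall x, `|dg x| <= M) ->
  s <= t -> RS_integral f g s t = H t - H s.
Proof.
move=> gd Hd fL dgM st; have h := is_RS_integral_primitive gd Hd fL dgM st.
apply: (is_RS_integral_unique st _ h); exact: xgetI h.
Qed.

(** * Derivatives of cosine sums and smooth lifts *)

Lemma is_derive_sum_fun (R : realType) (n : nat) (h : 'I_n -> R -> R) (dh : 'I_n -> R)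
    (x : R) :
  (forall i, is_derive x 1 (h i) (dh i)) ->
  is_derive x 1 (fun y => \sum_(i < n) h i y) (\sum_(i < n) dh i).
Proof.
move=> hd; have -> : (fun y => \sum_(i < n) h i y) = \sum_(i < n) h i.
  by apply/funext => y; rewrite fct_sumE.
exact: is_derive_sum.
Qed.

Lemma is_derive_cos_affine (R : realType) (p c x : R) :
  is_derive x 1 (fun y => cos (p * y + c)) (p * cos (p * x + c + pi / 2)).
Proof.
have h : is_derive x 1 (fun y : R => p * y + c) p.
  rewrite (_ : (fun y => _) = (p *: (id : R -> R)) + cst c) //.
  have := is_deriveD (is_deriveZ p (is_derive_id x (1 : R))) (is_derive_cst c x (1 : R)).
  by rewrite addr0 /GRing.scale /= mulr1.
have := @is_derive1_comp R (@cos R) (fun y : R => p * y + c) x _ _ (is_derive_cos _) h.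
by move=> hd; apply: (is_derive_eq hd); rewrite cosDpihalf mulrC.
Qed.

(** The n-th derivative of the partial sum of the Weierstrass series, as each
    differentiation of a cosine advances its phase by a quarter turn. *)
Definition cosine_sum_deriv (R : realType) (n : nat) (a : R) (b N : nat) (x : R) : R :=
  \sum_(k < N.+1) a ^+ k * (b%:R ^+ k * pi) ^+ n
                  * cos (b%:R ^+ k * pi * x + n%:R * (pi / 2)).

Lemma cosine_sum_deriv0 (R : realType) (a : R) (b N : nat) (x : R) :
  cosine_sum_deriv 0 a b N x = \sum_(k < N.+1) a ^+ k * cos (b%:R ^+ k * pi * x).
Proof. by apply: eq_bigr => k _; rewrite mulr1 mul0r addr0. Qed.

Lemma is_derive_cosine_sum (R : realType) (n : nat) (a : R) (b N : nat) (x : R) :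
  is_derive x 1 (cosine_sum_deriv n a b N) (cosine_sum_deriv n.+1 a b N x).
Proof.
apply: is_derive_sum_fun => k.
have := is_deriveZ (a ^+ k * (b%:R ^+ k * pi) ^+ n)
  (is_derive_cos_affine (b%:R ^+ k * pi) (n%:R * (pi / 2)) x).
move=> h; apply: (is_derive_eq h); rewrite /GRing.scale /= exprS.
rewrite (_ : n.+1%:R * (pi / 2) = n%:R * (pi / 2) + pi / 2 :> R); last first.
  by rewrite -natr1; ring.
by rewrite addrA; ring.
Qed.

Lemma cosine_sum_deriv_le (R : realType) (n : nat) (a : R) (b N : nat) (x : R) :
  0 <= a -> `|cosine_sum_deriv n a b N x| <= \sum_(k < N.+1) a ^+ k * (b%:R ^+ k * pi) ^+ n.
Proof.
move=> a0; apply: le_trans (ler_norm_sum _ _ _) _; apply: ler_sum => k _.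
have A0 : 0 <= a ^+ k * (b%:R ^+ k * pi) ^+ n.
  by rewrite !mulr_ge0 ?exprn_ge0 // mulr_ge0 ?exprn_ge0 ?pi_ge0.
by rewrite normrM (ger0_norm A0) ler_piMr // norm_cos_le1.
Qed.

Lemma is_derive_cos_dcos_primitive (R : realType) (p q x : R) : p + q != 0 ->
  is_derive x 1 (cos_dcos_primitive p q)
    (cos (p * pi * x) * (q * pi * cos (q * pi * x + pi / 2))).
Proof.
move=> pq0.
have dc (c : R) : is_derive x 1 (fun y => cos (c * pi * y)) (- (c * pi * sin (c * pi * x))).
  have := is_derive_cos_affine (c * pi) 0 x.
  rewrite addr0 cosDpihalf mulrN.
  by under eq_fun do rewrite addr0.
have h : is_derive x 1 (cos_dcos_primitive p q)
   ((q / 2) *: ((p + q)^-1 *: - ((p + q) * pi * sin ((p + q) * pi * x))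
             - (p - q)^-1 *: - ((p - q) * pi * sin ((p - q) * pi * x)))).
  rewrite (_ : cos_dcos_primitive p q = (q / 2) *: (
     (p + q)^-1 *: (fun y => cos ((p + q) * pi * y))
     - (p - q)^-1 *: (fun y => cos ((p - q) * pi * y)))).
    by apply: is_deriveZ; apply: is_deriveB; exact: is_deriveZ.
  by apply/funext => y; rewrite /cos_dcos_primitive; congr (_ * (_ - _)); exact: mulrC.
apply: (is_derive_eq h); rewrite /GRing.scale /= cosDpihalf.
rewrite (_ : (p + q) * pi * x = p * pi * x + q * pi * x); last by ring.
rewrite (_ : (p - q) * pi * x = p * pi * x - q * pi * x); last by ring.
have [pq|pq] := eqVneq p q.
  rewrite pq in pq0 *; rewrite subrr invr0 !mul0r subr0 sinD.
  by field.
rewrite sinD sinB; have : p - q != 0 by rewrite subr_eq0.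
by move=> pq1; field; rewrite pq0 pq1.
Qed.

Definition area_primitive (R : realType) (a : R) (b : nat) (a' : R) (b' N : nat)
    (s x : R) : R :=
  \sum_(k < N.+1) \sum_(l < N.+1) a ^+ k * a' ^+ l *
     (cos_dcos_primitive (b%:R ^+ k) (b'%:R ^+ l) x
      - cos (b%:R ^+ k * pi * s) * cos (b'%:R ^+ l * pi * x)).

Lemma area_partialE (R : realType) (a : R) (b : nat) (a' : R) (b' N : nat) (s t : R) :
  area_partial a b a' b' N s t =
  area_primitive a b a' b' N s t - area_primitive a b a' b' N s s.
Proof.
rewrite /area_primitive -sumrB; apply: eq_bigr => k _.
rewrite -sumrB; apply: eq_bigr => l _; rewrite /cos_area; ring.
Qed.

Lemma is_derive_area_primitive (R : realType) (a : R) (b : nat) (a' : R) (b' N : nat)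
    (s x : R) : (0 < b)%N -> (0 < b')%N ->
  is_derive x 1 (area_primitive a b a' b' N s)
    ((cosine_sum_deriv 0 a b N x - cosine_sum_deriv 0 a b N s)
     * cosine_sum_deriv 1 a' b' N x).
Proof.
move=> b0 b'0.
have -> : (cosine_sum_deriv 0 a b N x - cosine_sum_deriv 0 a b N s)
     * cosine_sum_deriv 1 a' b' N x =
  \sum_(k < N.+1) \sum_(l < N.+1) (a ^+ k * a' ^+ l) *:
    (cos (b%:R ^+ k * pi * x) * (b'%:R ^+ l * pi * cos (b'%:R ^+ l * pi * x + pi / 2))
     - cos (b%:R ^+ k * pi * s) *: (b'%:R ^+ l * pi * cos (b'%:R ^+ l * pi * x + 0 + pi / 2))).
  rewrite !cosine_sum_deriv0 -sumrB big_distrlr /=.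
  apply: eq_bigr => k _; apply: eq_bigr => l _.
  rewrite /GRing.scale /= addr0 expr1 mul1r; ring.
apply: is_derive_sum_fun => k; apply: is_derive_sum_fun => l.
apply: is_deriveZ; apply: is_deriveB.
  apply: is_derive_cos_dcos_primitive.
  by rewrite gt_eqF // addr_gt0 // exprn_gt0 // ltr0n.
have := is_deriveZ (cos (b%:R ^+ k * pi * s)) (is_derive_cos_affine (b'%:R ^+ l * pi) 0 x).
by under eq_fun do rewrite addr0.
Qed.

Lemma within01_dnbhs_proper (R : realType) (x : R) :
  0 <= x <= 1 -> ProperFilter (within `[0, 1]%classic x^').
Proof.
move=> /andP[x0 x1]; split; last exact: within_filter.
rewrite /within /= => /nbhs_ballP[e /= e0 sub].
pose h := Num.min (e / 2) (1 / 2).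
have h0 : 0 < h by rewrite lt_min !divr_gt0.
have he : h < e.
  have : h <= e / 2 by rewrite ge_min lexx.
  lra.
have h2 : h <= 1 / 2 by rewrite ge_min lexx orbT.
have [xs|xb] := leP x (1 / 2).
  apply: (sub (x + h)).
  - by rewrite /ball /= opprD addNKr normrN gtr0_norm.
  - by rewrite gt_eqF // ltrDl.
  - by rewrite in_itv /=; apply/andP; split; lra.
apply: (sub (x - h)).
- by rewrite /ball /= opprB addrC subrK gtr0_norm.
- by rewrite lt_eqF // gtrBl.
- by rewrite in_itv /=; apply/andP; split; lra.
Qed.

Lemma diff_quotient01_cvg (R : realType) (f D : R -> R) (d x : R) :
  (forall y, 0 <= y <= 1 -> f y = D y) -> is_derive x 1 D d -> 0 <= x <= 1 ->
  diff_quotient01 f x --> d.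
Proof.
move=> fD [Dx Dd] x01; rewrite /diff_quotient01.
have : (fun h : R => h^-1 *: ((D \o shift x) (h *: 1) - D x)) @ 0^' --> d.
  by rewrite -Dd; exact: Dx.
move=> /cvgrPdist_lt Dlim; apply/cvgrPdist_lt => e e0.
have := Dlim e e0; rewrite /within /= => /nbhs_ballP[r /= r0 sub].
apply/nbhs_ballP; exists r => //= y xy yx y01.
move: y01; rewrite /= in_itv /= => y01; rewrite !fD //.
have := sub (y - x); rewrite /ball /= sub0r normrN distrC => /(_ xy).
rewrite subr_eq0 => /(_ yx) /=; rewrite /GRing.scale /= mulr1 subrK.
by rewrite mulrC.
Qed.

Lemma deriv01E (R : realType) (f D : R -> R) (d x : R) :
  (forall y, 0 <= y <= 1 -> f y = D y) -> is_derive x 1 D d -> 0 <= x <= 1 ->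
  deriv01 f x = d.
Proof.
move=> fD Dd x01; have P := within01_dnbhs_proper x01.
by apply: cvg_lim => //; exact: diff_quotient01_cvg fD Dd x01.
Qed.

Lemma smooth01_iter (R : realType) (f : R -> R) (D : nat -> R -> R) :
  f =1 D 0 -> (forall n (x : R), is_derive x 1 (D n) (D n.+1 x)) ->
  smooth01 f.
Proof.
move=> fD Dd n x x01.
have it m y : 0 <= y <= 1 -> iter m (@deriv01 R) f y = D m y.
  elim: m y => [|m IH] y y01; first exact: fD.
  exact: deriv01E IH (Dd m y) y01.
apply/cvg_ex; exists (D n.+1 x); exact: diff_quotient01_cvg (it n) (Dd n x) x01.
Qed.

Lemma Rintegral_primitive (R : realType) (f F : R -> R) (s t : R) :
  s <= t -> continuous f -> (forall x : R, is_derive x 1 F (f x)) ->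
  \int[lebesgue_measure]_(x in `[s, t]%classic) f x = F t - F s.
Proof.
move=> st cf Fd; have cF := is_derive_continuous Fd.
have [->|st'] := eqVneq s t; first by rewrite set_itv1 Rintegral_set1 subrr.
rewrite /Rintegral (@continuous_FTC2 _ f F) //.
- by rewrite lt_neqAle st' st.
- exact: continuous_subspaceT.
- split=> //.
  + by apply: cvg_at_right_filter; exact: cF.
  + by apply: cvg_at_left_filter; exact: cF.
- by move=> x _; rewrite derive1E; exact: derive_val.
Qed.

Section weierstrass_sums.
Variables (R : realType) (d : nat) (a : 'I_d -> R) (b : 'I_d -> nat).
Hypotheses (a0 : forall i, 0 < a i) (b1 : forall i, (1 < b i)%N).

Lemma weierstrass_partialE N t i :
  weierstrass_partial a b N t 0 i = cosine_sum_deriv 0 (a i) (b i) N t.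
Proof. by rewrite mxE big_mkord cosine_sum_deriv0. Qed.

Lemma iterated_integralE i j s t N : s <= t ->
  iterated_integral a b i j s t N = area_partial (a i) (b i) (a j) (b j) N s t.
Proof.
move=> st; rewrite area_partialE /iterated_integral.
under [X in RS_integral X]eq_fun do rewrite !weierstrass_partialE.
under [X in RS_integral _ X]eq_fun do rewrite weierstrass_partialE.
have ai := ltW (a0 i); have aj := ltW (a0 j).
apply: (RS_integral_primitive
  (Lf := \sum_(k < N.+1) a i ^+ k * ((b i)%:R ^+ k * pi) ^+ 1)
  (is_derive_cosine_sum 0 (a j) (b j) N) _ _
  (fun x => cosine_sum_deriv_le 1 (b j) N x aj) st).
  by move=> x; apply: is_derive_area_primitive; exact: ltnW.
move=> x y; rewrite opprB addrA subrK.
wlog yx : x y / y <= x.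
  move=> h; case/orP: (le_total x y) => [/h|/h //].
  by rewrite distrC [X in _ <= _ * X]distrC.
have [c _ ->] := mean_value (is_derive_cosine_sum 0 (a i) (b i) N) yx.
by rewrite normrM ler_wpM2r // cosine_sum_deriv_le.
Qed.

Lemma smooth_weierstrass_partial N : smooth_path (weierstrass_partial a b N).
Proof.
move=> i; apply: (@smooth01_iter _ _ (fun n => cosine_sum_deriv n (a i) (b i) N)).
  by move=> x; rewrite weierstrass_partialE.
move=> n x; exact: is_derive_cosine_sum.
Qed.

Lemma smooth_lift_weierstrass_partial N s t : 0 <= s -> s <= t -> t <= 1 ->
  smooth_lift (weierstrass_partial a b N) s t =
  (weierstrass_partial a b N t - weierstrass_partial a b N s,
   \matrix_(i, j) area_partial (a i) (b i) (a j) (b j) N s t).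
Proof.
move=> s0 st t1; rewrite /smooth_lift; congr pair; apply/matrixP => i j; rewrite !mxE.
rewrite area_partialE.
have int := @Rintegral_primitive _ (fun x => (cosine_sum_deriv 0 (a i) (b i) N x
    - cosine_sum_deriv 0 (a i) (b i) N s) * cosine_sum_deriv 1 (a j) (b j) N x)
  (area_primitive (a i) (b i) (a j) (b j) N s) s t st.
apply: etrans (int _ _).
- apply: eq_Rintegral => x; rewrite inE /= in_itv /= => /andP[sx xt].
  rewrite weierstrass_partialE big_mkord -cosine_sum_deriv0; congr (_ * _).
  apply: (deriv01E (D := cosine_sum_deriv 0 (a j) (b j) N)).
  + by move=> y _; rewrite weierstrass_partialE.
  + exact: is_derive_cosine_sum.
  + by rewrite (le_trans s0 sx) (le_trans xt t1).
- move=> x; apply: cvgM.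
    apply: cvgB; last exact: cvg_cst.
    exact: is_derive_continuous (is_derive_cosine_sum 0 (a i) (b i) N) x.
  exact: is_derive_continuous (is_derive_cosine_sum 1 (a j) (b j) N) x.
- by move=> x; apply: is_derive_area_primitive; exact: ltnW.
Qed.

End weierstrass_sums.

(** * Hoelder bounds and the limiting rough path *)

Lemma uniform_geometric (R : realFieldType) (I : finType) (C z : I -> R) :
  (forall i, 0 <= C i) -> (forall i, 0 <= z i < 1) ->
  exists C0 z0, [/\ 0 <= C0, 0 <= z0 < 1 & forall i n, C i * z i ^+ n <= C0 * z0 ^+ n].
Proof.
move=> C0 z01; pose z0 := \big[Num.max/0]_i z i.
have zz i : z i <= z0 by exact: le_bigmax.
have z00 : 0 <= z0 by exact: bigmax_ge_id.
exists (\sum_i C i), z0; split.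
- exact: sumr_ge0.
- by rewrite z00; apply: bigmax_lt => // i _; have /andP[] := z01 i.
move=> i n; have /andP[zi0 _] := z01 i; rewrite ler_pM ?exprn_ge0 //.
  by rewrite (bigD1 i) //= lerDl sumr_ge0.
by rewrite lerXn2r.
Qed.

Lemma mx_norm_le (R : realFieldType) (m n : nat) (A : 'M[R]_(m, n)) (c : R) :
  0 <= c -> (forall i j, `|A i j| <= c) -> `|A| <= c.
Proof.
by move=> c0 Ac; rewrite [leLHS]mx_normrE; apply: bigmax_le => // -[i j] _; exact: Ac.
Qed.

Lemma holder2_norm_le (R : realType) (V : normedModType R) (gam c : R) (F : R -> R -> V) :
  (forall s t, 0 <= s -> s <= t -> t <= 1 -> `|F s t| <= c * `|t - s| `^ gam) ->
  (holder2_norm gam F <= c%:E)%E.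
Proof.
move=> Fc; apply: ge_ereal_sup => _ [[s t] /= [s0 st t1 ne] <-].
rewrite lee_fin ler_pdivrMr ?Fc // powR_gt0 // normr_gt0 subr_eq0 eq_sym.
exact: ne.
Qed.

Lemma holder_norm_le (R : realType) (d : nat) (gam c : R) (X : R -> 'rV[R]_d) :
  (forall s t, `|X t - X s| <= c * `|t - s| `^ gam) -> (holder_norm gam X <= c%:E)%E.
Proof.
move=> Xc; apply: ge_ereal_sup => _ [[s t] /= [s0 t0 ne] <-].
rewrite lee_fin ler_pdivrMr ?Xc // powR_gt0 // normr_gt0 subr_eq0 eq_sym.
exact: ne.
Qed.

Lemma rough_norm_le (R : realType) (d : nat) (gam c : R)
    (XX : R -> R -> 'rV[R]_d * 'M[R]_d) : 0 <= c ->
  (forall s t i, 0 <= s -> s <= t -> t <= 1 -> `|(XX s t).1 0 i| <= c * `|t - s| `^ gam) ->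
  (forall s t i j, 0 <= s -> s <= t -> t <= 1 ->
     `|(XX s t).2 i j| <= c * `|t - s| `^ (2 * gam)) ->
  (rough_norm gam XX <= (c + c)%:E)%E.
Proof.
move=> c0 X1 X2; rewrite EFinD; apply: leeD; apply: holder2_norm_le => s t s0 st t1;
  apply: mx_norm_le; rewrite ?mulr_ge0 ?powR_ge0 //.
  by move=> i j; rewrite ord1; exact: X1.
by move=> i j; exact: X2.
Qed.

Lemma holder_exponent (R : realType) (a gam : R) (b : nat) : 0 < a -> (1 < b)%N ->
  gam < - (ln a / ln b%:R) -> a * b%:R `^ gam < 1.
Proof.
move=> a0 b1 h; have b0 : 0 < b%:R :> R by rewrite ltr0n ltnW.
have lb : 0 < ln (b%:R : R) by have := ln_nat_ge_half R b1; lra.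
rewrite -[a]lnK ?posrE // /powR gt_eqF // -expRD expR_lt1.
by move: h; rewrite -mulNr ltr_pdivlMr //; lra.
Qed.

Lemma common_exponent (R : realFieldType) (d : nat) (al : 'I_d -> R) :
  (forall i, 1 / 3 < al i) ->
  exists gam : R, 1 / 3 < gam <= 1 / 2 /\ forall i, gam < al i.
Proof.
move=> h; exists (\big[Num.min/(1 / 2)]_i ((1 / 3 + al i) / 2)); split.
  rewrite bigmin_le_id andbT; apply: lt_bigmin; first lra.
  by move=> i _; have := h i; lra.
move=> i; apply: (@le_lt_trans _ _ ((1 / 3 + al i) / 2)); first exact: bigmin_le.
by have := h i; lra.
Qed.

Section weierstrass_limits.
Variables (R : realType) (d : nat) (a : 'I_d -> R) (b : 'I_d -> nat) (gam : R).
Hypotheses (a0 : forall i, 0 < a i) (b1 : forall i, (1 < b i)%N)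
  (abg : forall i, a i * (b i)%:R `^ gam < 1).

(** With gam = 0 this is the bare existence of the limit; with gam > 1/3 it
    bounds the second level of the rough path and its approximations. *)
Lemma iterated_integral_cvg i j : 0 <= gam <= 1 / 2 ->
  exists Cz : R * R, [/\ 0 <= Cz.1, 0 <= Cz.2 < 1 & forall s t, s <= t ->
    [/\ cvgn (iterated_integral a b i j s t),
      `|limn (iterated_integral a b i j s t)| <= Cz.1 * `|t - s| `^ (2 * gam) &
      forall N, `|limn (iterated_integral a b i j s t)
                 - area_partial (a i) (b i) (a j) (b j) N s t|
        <= Cz.1 * Cz.2 ^+ N * `|t - s| `^ (2 * gam)]].
Proof.
move=> g.
have [C [z [C0 z01 h0 hN]]] :=
  area_partial_step (a0 i) (a0 j) (b1 i) (b1 j) g (abg i) (abg j).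
have /andP[z0 z1] := z01.
have D0 : 0 <= C / (1 - z) by rewrite divr_ge0 // subr_ge0 ltW.
exists (C + C / (1 - z), z); split => //=; first by rewrite addr_ge0.
move=> s t st.
have -> : iterated_integral a b i j s t =
    fun N => area_partial (a i) (b i) (a j) (b j) N s t.
  by apply/funext => N; rewrite iterated_integralE.
have [cv lim_] := geometric_cauchy z01 (fun N => hN N s t).
set T := `|t - s| `^ _ in lim_ *; have T0 : 0 <= T by exact: powR_ge0.
split=> //.
  rewrite -[limn _](subrK (area_partial (a i) (b i) (a j) (b j) 0 s t)).
  apply: le_trans (ler_normD _ _) _.
  apply: le_trans (lerD (lim_ 0%N) (h0 s t)) _; rewrite -/T mulr1; lra.
move=> N; apply: le_trans (lim_ N) _.
have : 0 <= C * z ^+ N * T by rewrite !mulr_ge0 // exprn_ge0.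
lra.
Qed.

Lemma weierstrass_series_cvg i t : 0 <= gam ->
  cvgn (series (fun k => a i ^+ k * cos ((b i)%:R ^+ k * pi * t))).
Proof.
move=> g0; have ai1 : a i < 1.
  apply: le_lt_trans (abg i); rewrite ler_peMr ?(ltW (a0 i)) //.
  have bi : 1 <= (b i)%:R :> R by rewrite ler1n ltnW.
  by have := ler_powR bi g0; rewrite powRr0.
have [|n|//] := @geometric_cauchy _ (series (fun k => a i ^+ k * cos ((b i)%:R ^+ k * pi * t))) 1 (a i).
  by rewrite ltW.
rewrite /series /= big_nat_recr //= [X in `|X|]addrC addKr mul1r normrM.
by rewrite ger0_norm ?exprn_ge0 ?(ltW (a0 i)) // ler_piMr ?exprn_ge0 ?(ltW (a0 i)) // norm_cos_le1.
Qed.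

(** Applied to the partial sums of the increment between s and t, whose successive
    differences are at most 8 |t - s| ^ gam (a b ^ gam) ^ n. *)
Lemma weierstrass_holder i : 0 <= gam <= 1 / 2 ->
  exists Cz : R * R, [/\ 0 <= Cz.1, 0 <= Cz.2 < 1 & forall s t,
    `|weierstrass a b t 0 i - weierstrass a b s 0 i| <= Cz.1 * `|t - s| `^ gam /\
    forall N, `|weierstrass a b t 0 i - weierstrass a b s 0 i
       - (weierstrass_partial a b N t 0 i - weierstrass_partial a b N s 0 i)|
        <= Cz.1 * Cz.2 ^+ N * `|t - s| `^ gam].
Proof.
move=> /andP[g0 g2]; set z := a i * (b i)%:R `^ gam.
have z01 : 0 <= z < 1 by rewrite abg andbT mulr_ge0 ?powR_ge0 // ltW.
have /andP[z0 z1] := z01.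
have C0 : 0 <= 8 / (1 - z) by rewrite divr_ge0 // subr_ge0 ltW.
exists (8 / (1 - z), z); split => //= s t; set T := `|t - s| `^ gam.
have T0 : 0 <= T by exact: powR_ge0.
pose u r k := a i ^+ k * cos ((b i)%:R ^+ k * pi * r).
pose y n := series (u t) n - series (u s) n.
have step n : `|y n.+1 - y n| <= 8 * T * z ^+ n.
  rewrite /y !seriesEnat /= !big_nat_recr //=.
  rewrite (_ : _ - _ = a i ^+ n * (cos ((b i)%:R ^+ n * pi * t)
    - cos ((b i)%:R ^+ n * pi * s))); last by rewrite /u; ring.
  have g01 : 0 <= gam <= 1 by lra.
  have := @cos_osc _ ((b i)%:R ^+ n) s t gam g01.
  rewrite normrM (gtr0_norm (exprn_gt0 n (a0 i))) (ger0_norm (exprn_ge0 n (ler0n R (b i)))).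
  rewrite powR_exprn // -/T => osc.
  apply: (@le_trans _ _ (a i ^+ n * (8 * ((b i)%:R `^ gam ^+ n * T)))).
    by rewrite ler_wpM2l // exprn_ge0 // ltW.
  by rewrite /z exprMn le_eqVlt; apply/orP; left; apply/eqP; ring.
have [_ lim_] := geometric_cauchy z01 step.
have yE : limn y = weierstrass a b t 0 i - weierstrass a b s 0 i.
  rewrite !mxE; apply: cvg_lim => //.
  by apply: cvgB; exact: weierstrass_series_cvg g0.
split.
  have := lim_ 0%N; rewrite yE /y !seriesEnat /= !big_geq // subrr subr0 mulr1.
  by move=> /le_trans; apply; lra.
move=> N; have := lim_ N.+1.
have -> : y N.+1 = weierstrass_partial a b N t 0 i - weierstrass_partial a b N s 0 i.
  by rewrite /weierstrass_partial !mxE.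
rewrite yE => /le_trans; apply.
have : z ^+ N.+1 <= z ^+ N by rewrite exprS ler_piMl ?exprn_ge0 // ltW.
rewrite -subr_ge0 => h; have := mulr_ge0 (mulr_ge0 C0 T0) h.
lra.
Qed.

End weierstrass_limits.

(** Additivity of the integral leaves the increment of the integrand between s
    and u, times that of the integrator between u and t, for each pair of
    frequencies. *)
Lemma area_partial_chen (R : realType) (a : R) (b : nat) (a' : R) (b' N : nat) (s u t : R) :
  area_partial a b a' b' N s t - area_partial a b a' b' N s u - area_partial a b a' b' N u t
  = (cosine_sum_deriv 0 a b N u - cosine_sum_deriv 0 a b N s)
    * (cosine_sum_deriv 0 a' b' N t - cosine_sum_deriv 0 a' b' N u).
Proof.
rewrite !cosine_sum_deriv0 -!sumrB big_distrlr /=; apply: eq_bigr => k _.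
rewrite -!sumrB; apply: eq_bigr => l _; rewrite /cos_area; ring.
Qed.

Unset Implicit Arguments.

Theorem theorem1p1 (R : realType) (d : nat) (hd : (1 <= d)%N)
    (a : 'I_d -> R) (b : 'I_d -> nat)
    (ha : forall i, 0 < a i < 1) (hb : forall i, (2 <= b i)%N)
    (hab : forall i, 1 < a i * (b i)%:R) :
  (forall (i j : 'I_d) (s t : R), 0 <= s -> s <= t -> t <= 1 ->
     cvgn (iterated_integral a b i j s t)) /\
  ((forall i, 1 / 3 < - (ln (a i) / ln (b i)%:R)) ->
   exists gam : R,
     [/\ 1 / 3 < gam <= 1 / 2,
         rough_path_above gam (weierstrass a b) (weierstrass_lift a b) &
         geometric_rough_path gam (weierstrass_lift a b)]).
Proof.
have a0 i : 0 < a i by have /andP[] := ha i.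
split.
  move=> i j s t _ st _.
  have a1 k : a k * (b k)%:R `^ 0 < 1 by rewrite powRr0 mulr1; have /andP[] := ha k.
  have [|Cz [_ _ h]] := @iterated_integral_cvg R d a b 0 a0 hb a1 i j; first by lra.
  by have [] := h s t st.
move=> al; have [gam [gam13 gal]] := common_exponent al.
have abg i : a i * (b i)%:R `^ gam < 1 by exact: holder_exponent (a0 i) (hb i) (gal i).
have g01 : 0 <= gam <= 1 / 2 by lra.
(* One constant and one ratio serve for all the indices i and all the pairs
   (i, j). *)
have [Cz1 h1] := choice (fun i => weierstrass_holder a0 hb abg i g01).
have [Cz2 h2] := choice (fun ij : 'I_d * 'I_d => iterated_integral_cvg a0 hb abg ij.1 ij.2 g01).
pose C (x : 'I_d + 'I_d * 'I_d) := match x with inl i => (Cz1 i).1 | inr ij => (Cz2 ij).1 end.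
pose z (x : 'I_d + 'I_d * 'I_d) := match x with inl i => (Cz1 i).2 | inr ij => (Cz2 ij).2 end.
have [C0 [z0 [C00 z01 hC]]] : exists C0 z0, [/\ 0 <= C0, 0 <= z0 < 1 &
    forall i n, C i * z i ^+ n <= C0 * z0 ^+ n].
  apply: uniform_geometric => -[i|ij] /=.
  - by have [] := h1 i.
  - by have [] := h2 ij.
  - by have [] := h1 i.
  - by have [] := h2 ij.
have W1 i s t : `|weierstrass a b t 0 i - weierstrass a b s 0 i| <= C0 * `|t - s| `^ gam.
  have [_ _ /(_ s t) [h _]] := h1 i; apply: le_trans h _; rewrite ler_wpM2r ?powR_ge0 //.
  by have := hC (inl i) 0%N; rewrite !mulr1.
have W2 i s t N : `|weierstrass a b t 0 i - weierstrass a b s 0 i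
       - (weierstrass_partial a b N t 0 i - weierstrass_partial a b N s 0 i)|
     <= C0 * z0 ^+ N * `|t - s| `^ gam.
  have [_ _ /(_ s t) [_ h]] := h1 i; apply: le_trans (h N) _; rewrite ler_wpM2r ?powR_ge0 //.
  exact: (hC (inl i)).
have I1 i j s t : s <= t ->
    `|limn (iterated_integral a b i j s t)| <= C0 * `|t - s| `^ (2 * gam).
  move=> st; have [_ _ /(_ s t st) [_ h _]] := h2 (i, j).
  apply: le_trans h _; rewrite ler_wpM2r ?powR_ge0 //.
  by have := hC (inr (i, j)) 0%N; rewrite !mulr1.
have I2 i j s t N : s <= t -> `|limn (iterated_integral a b i j s t)
      - area_partial (a i) (b i) (a j) (b j) N s t|
    <= C0 * z0 ^+ N * `|t - s| `^ (2 * gam).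
  move=> st; have [_ _ /(_ s t st) [_ _ h]] := h2 (i, j).
  apply: le_trans (h N) _; rewrite ler_wpM2r ?powR_ge0 //.
  exact: (hC (inr (i, j))).
have z0N : z0 ^+ N @[N --> \oo] --> 0.
  by apply: cvg_expr; have /andP[z00 z1] := z01; rewrite ger0_norm.
have CzN : C0 * z0 ^+ N @[N --> \oo] --> 0.
  by rewrite -[X in _ --> X](mulr0 C0); apply: cvgM => //; exact: cvg_cst.
have areaC i j s t : s <= t -> area_partial (a i) (b i) (a j) (b j) N s t @[N --> \oo]
    --> limn (iterated_integral a b i j s t).
  move=> st; have [_ _ /(_ s t st) [h _ _]] := h2 (i, j).
  rewrite (_ : (fun N => _) = iterated_integral a b i j s t) //.
  by apply/funext => N; rewrite iterated_integralE.
have WC i s t : cosine_sum_deriv 0 (a i) (b i) N t - cosine_sum_deriv 0 (a i) (b i) N s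
    @[N --> \oo] --> weierstrass a b t 0 i - weierstrass a b s 0 i.
  apply/cvgrPdist_le => e e0.
  have : C0 * z0 ^+ N * `|t - s| `^ gam @[N --> \oo] --> 0.
    by rewrite -[X in _ --> X](mul0r (`|t - s| `^ gam)); apply: cvgM => //; exact: cvg_cst.
  move=> /cvgr_le /(_ e e0); apply: filterS => N; apply: le_trans.
  by have := W2 i s t N; rewrite !weierstrass_partialE.
have above : rough_path_above gam (weierstrass a b) (weierstrass_lift a b).
  split=> //.
  - apply: (@le_lt_trans _ _ C0%:E); last exact: ltry.
    apply: holder_norm_le => s t; apply: mx_norm_le; first by rewrite mulr_ge0 ?powR_ge0.
    by move=> i j; have := W1 j s t; rewrite ord1 !mxE.
  - move=> s u t s0 su ut t1; apply/matrixP => i j.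
    have st := le_trans su ut.
    have lhs := cvgB (cvgB (areaC i j s t st) (areaC i j s u su)) (areaC i j u t ut).
    have rhs := cvgM (WC i s u) (WC j u t).
    have {}lhs := lhs eventually_filter eventually_filter.
    have {}rhs := rhs eventually_filter.
    have : limn (iterated_integral a b i j s t) - limn (iterated_integral a b i j s u)
        - limn (iterated_integral a b i j u t)
      = (weierstrass a b u 0 i - weierstrass a b s 0 i)
        * (weierstrass a b t 0 j - weierstrass a b u 0 j).
      rewrite -(cvg_lim _ lhs) // -(cvg_lim _ rhs) //; congr (limn _).
      by apply/funext => N; exact: area_partial_chen.
    by rewrite !mxE.
  - apply: (@le_lt_trans _ _ (C0 + C0)%:E); last exact: ltry.
    apply: rough_norm_le => // s t i.
      by move=> _ _ _; have := W1 i s t; rewrite !mxE.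
    by move=> j s0 st t1; rewrite mxE; exact: I1.
exists gam; split=> //; split; first by exists (weierstrass a b).
move=> eps eps0.
have [N hN] : exists N, C0 * z0 ^+ N + C0 * z0 ^+ N < eps.
  have [N _ /(_ N (leqnn N)) hN] := cvgr_lt _ CzN _ (divr_gt0 eps0 (ltr0Sn R 1)).
  exists N; move: hN => /=; lra.
exists (weierstrass_partial a b N); first exact: smooth_weierstrass_partial.
apply: le_lt_trans (_ : _ <= (C0 * z0 ^+ N + C0 * z0 ^+ N)%:E)%E _; last by rewrite lte_fin.
apply: rough_norm_le.
- by rewrite mulr_ge0 // exprn_ge0 //; have /andP[] := z01.
- by move=> s t i s0 st t1; rewrite smooth_lift_weierstrass_partial //=; have := W2 i s t N; rewrite !mxE.
- move=> s t i j s0 st t1; rewrite smooth_lift_weierstrass_partial //=.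
  by have := I2 i j s t N st; rewrite !mxE.
Qed.
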